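(* Let $0<\alpha\le2$, $q>4(1+\alpha)+5$ and $T>0$. Let $u_N(t)$ be the exact semi-discrete Fourier--Galerkin solution of the fractional Zakharov--Kuznetsov equation with $u_N(0)=\Pi_N u_0$, and let $u_N^n$, $0\le n\le M$, be the fully discrete solution generated by the integrating-factor RK4 scheme with time step $\Delta t=T/M$ and $u_N^0=u_N(0)=\Pi_N u_0$. Assume that there exists a constant $R>0$, independent of $N$ and $\Delta t$, such that $$\sup_{0\le t\le T}\|u_N(t)\|_q\le R .$$ Moreover, for each $n$ let $w_N^n(t)$ be the exact semi-discrete solution on $[t_n,t_{n+1}]$ with initial value $w_N^n(t_n)=u_N^n$, and assume that $$\sup_{0\le n\le M-1}\ \sup_{t_n\le t\le t_{n+1}}\|w_N^n(t)\|_q\le R .$$ Then there is $h_0=h_0(R,q,\alpha,\Omega)>0$ such that, for $\Delta t\le h_0$, there exists a constant $C>0$, independent of $N$ and $\Delta t$, with $$\max_{0\le n\le M}\|u_N(t_n)-u_N^n\|\le C\Delta t^4 .$$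
   Context: $\Omega=[-\pi,\pi]^2$ with periodic boundary conditions (the two-dimensional torus), $\mathbf x=(x_1,x_2)$. All functions are real-valued; $u_0\in L^2_{\mathrm{per}}(\Omega)$. $(u,v)=\int_\Omega u\overline v\,d\mathbf x$ and $\|\cdot\|$ are the $L^2_{\mathrm{per}}(\Omega)$ inner product and norm, $\hat f(\mathbf k)=(2\pi)^{-2}\int_\Omega f e^{-i\mathbf k\cdot\mathbf x}\,d\mathbf x$, $\|u\|_q^2=\sum_{\mathbf k\in\mathbb Z^2}(1+|\mathbf k|^2)^q|\hat u(\mathbf k)|^2$. $(-\Delta)^{\alpha/2}$ is the Fourier multiplier with symbol $|\mathbf k|^\alpha$. $\mathbb X_N$ is the space of (real-valued) trigonometric polynomials in $\mathrm{span}\{e^{i\mathbf k\cdot\mathbf x}:\max\{|k_1|,|k_2|\}\le N\}$, and $\Pi_N$ is the $L^2$-orthogonal projection onto it. The exact semi-discrete (Galerkin) equation for functions with values in $\mathbb X_N$ is $$(\partial_t u_N, v) + ((-\Delta)^{\alpha/2} u_N, \partial_{x_1} v) - \tfrac12 (u_N^2, \partial_{x_1} v) = 0 \quad \forall v\in\mathbb X_N .$$ Identifying elements of $\mathbb X_N$ with their Fourier coefficient vectors, it reads $\frac{dU}{dt}=LU+\mathcal N(U)$, where $L$ is the Fourier multiplier with symbol $L_{\mathbf m}=im_1|\mathbf m|^\alpha$ and $\mathcal N(Y)=-\frac12\Pi_N\partial_{x_1}(Y^2)$. With $V=e^{-Lt}U$ it becomes $\frac{dV}{dt}=\mathcal F(t,V):=e^{-Lt}\mathcal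 N(e^{Lt}V)$. The integrating-factor RK4 scheme: for $M\in\mathbb N$, $\Delta t=T/M$, $t_n=n\Delta t$, set $V^0=\Pi_N u_0$ and $$V^{n+1}=V^n+\tfrac16(k_1+2k_2+2k_3+k_4),$$ $k_1=\Delta t\,\mathcal F(t_n,V^n)$, $k_2=\Delta t\,\mathcal F(t_n+\frac{\Delta t}2,V^n+\frac{k_1}2)$, $k_3=\Delta t\,\mathcal F(t_n+\frac{\Delta t}2,V^n+\frac{k_2}2)$, $k_4=\Delta t\,\mathcal F(t_n+\Delta t,V^n+k_3)$, and $u_N^n=e^{Lt_n}V^n$. ''Independent of $N$ and $\Delta t$'' means uniform over all pairs $(N,M)$ for which the stated bounds hold with the given $R$. *)

(* Defs.v *)
From HB Require Import structures.
From mathcomp Require Import all_boot all_order all_algebra.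
From mathcomp Require Import complex zify.
From mathcomp Require Import all_classical all_reals all_analysis.

Set Implicit Arguments.
Unset Strict Implicit.
Unset Printing Implicit Defensive.

Import Order.TTheory GRing.Theory Num.Theory.
Import numFieldNormedType.Exports.

Local Open Scope classical_set_scope.
Local Open Scope ring_scope.
Local Open Scope complex_scope.

Section FourierGalerkin.
Variable R : realType.

(* Functions on the torus are represented by functions on the plane. *)
Local Notation plane := (measurableTypeR R * measurableTypeR R)%type.

Definition Omega : set plane := `[- pi, pi] `*` `[- pi, pi].

Definition leb2 : {measure set plane -> \bar R} :=
  (@lebesgue_measure R \x @lebesgue_measure R)%E.

Definition intO (f : plane -> R) : R := \int[leb2]_(x in Omega) f x.

Definition intOC (f : plane -> R[i]) : R[i] :=
  intO (fun x => complex.Re (f x)) +i* intO (fun x => complex.Im (f x)).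

(* No conjugation: all functions are real-valued. *)
Definition inner (f g : plane -> R) : R := intO (fun x => f x * g x).

Definition L2norm (f : plane -> R) : R := Num.sqrt (inner f f).

Definition periodic (f : plane -> R) : Prop :=
  forall x1 x2, f (x1 + 2 * pi, x2) = f (x1, x2) /\
                f (x1, x2 + 2 * pi) = f (x1, x2).

Definition L2per (f : plane -> R) : Prop :=
  [/\ periodic f, measurable_fun [set: plane] f &
      (\int[leb2]_(x in Omega) ((f x) ^+ 2)%:E < +oo)%E].

Definition Cexp (z : R[i]) : R[i] :=
  (expR (complex.Re z))%:C *
  (cos (complex.Im z) +i* sin (complex.Im z)).

Definition freq : Type := (int * int)%type.

Definition dot (k : freq) (x : plane) : R := k.1%:~R * x.1 + k.2%:~R * x.2.

Definition sqlen (k : freq) : R := k.1%:~R ^+ 2 + k.2%:~R ^+ 2.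

Definition len (k : freq) : R := Num.sqrt (sqlen k).

Definition mode (k : freq) (x : plane) : R[i] := Cexp ('i * (dot k x)%:C).

Definition fhat (f : plane -> R) (k : freq) : R[i] :=
  ((2 * pi) ^- 2)%:C * intOC (fun x => (f x)%:C * Cexp (- ('i * (dot k x)%:C))).

(* The Sobolev norm, possibly +oo. *)
Definition Hnorm (q : R) (f : plane -> R) : \bar R :=
  poweR (\esum_(k in [set: freq])
    ((1 + sqlen k) `^ q * ComplexField.Normc.normc (fhat f k) ^+ 2)%:E)%E 2^-1.

Definition freqs (N : nat) : seq freq :=
  [seq (i%:Z - N%:Z, j%:Z - N%:Z) | i <- iota 0 N.*2.+1, j <- iota 0 N.*2.+1].

Lemma mem_freqs (N : nat) (k : freq) :
  (k \in freqs N) = (maxn `|k.1|%N `|k.2|%N <= N)%N.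
Proof.
case: k => k1 k2; rewrite geq_max; apply/allpairsP/andP.
  case=> -[i j] []; rewrite !mem_iota !add0n => /= hi hj [-> ->].
  by split; lia.
move=> [h1 h2]; rewrite /= in h1 h2; exists (`|(k1 + N%:Z)%R|%N, `|(k2 + N%:Z)%R|%N).
by rewrite !mem_iota !add0n; split=> /=; [lia|lia|congr pair; lia].
Qed.

Lemma freqs_uniq (N : nat) : uniq (freqs N).
Proof.
apply: allpairs_uniq; try exact: iota_uniq.
by move=> [i j] [i' j'] _ _ /= [/addIr[->] /addIr[->]].
Qed.

Definition XN (N : nat) : set (plane -> R) :=
  [set f | exists c : freq -> R[i],
     forall x, (f x)%:C = \sum_(k <- freqs N) c k * mode k x].

(* The L2-orthogonal projection onto [XN N]: [xget] selects the element
   characterized by the bracketed property. *)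
Definition PiN (N : nat) (f : plane -> R) : plane -> R :=
  xget (fun=> 0)
    [set p | XN N p /\ forall v, XN N v -> inner (fun x => f x - p x) v = 0].

(* The Fourier multiplier with symbol [m] acting on [XN N].  For [f] in [XN N]
   the Fourier series has no other terms, and for symbols with
   m (- k) = (m k)^* (as all the symbols below) the sum is real already, so that
   [Re] only changes its type. *)
Definition fmult (N : nat) (m : freq -> R[i]) (f : plane -> R) : plane -> R :=
  fun x => complex.Re (\sum_(k <- freqs N) m k * fhat f k * mode k x).

Definition fracLap (N : nat) (alpha : R) : (plane -> R) -> plane -> R :=
  fmult N (fun k => (len k `^ alpha)%:C).

Definition Dx1 (f : plane -> R) : plane -> R :=
  fun x => derive1 (fun s : R => f (s, x.2)) x.1.

(* Solutions on [a, b] are continuous on [a, b] and solve the equation on the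
   open interval.  As [XN N] has finite dimension, continuity and
   differentiability in time can be taken pointwise in space. *)
Definition semidiscrete (N : nat) (alpha a b : R) (u : R -> plane -> R) : Prop :=
  [/\ forall t, a <= t <= b -> XN N (u t),
      forall x, {within `[a, b], continuous (fun t => u t x)},
      forall x t, a < t < b -> derivable (fun s => u s x) t 1 &
      forall t, a < t < b -> forall v, XN N v ->
        inner (fun x => derive1 (fun s => u s x) t) v
        + inner (fracLap N alpha (u t)) (Dx1 v)
        - 2^-1 * inner (fun x => u t x ^+ 2) (Dx1 v) = 0].

Definition Lsym (alpha : R) (k : freq) : R[i] :=
  'i * (k.1%:~R * len k `^ alpha)%:C.

Definition expL (N : nat) (alpha t : R) : (plane -> R) -> plane -> R :=
  fmult N (fun k => Cexp (t%:C * Lsym alpha k)).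

Definition nonlin (N : nat) (Y : plane -> R) : plane -> R :=
  fun x => - 2^-1 * PiN N (Dx1 (fun y => Y y ^+ 2)) x.

Definition rhsF (N : nat) (alpha t : R) (V : plane -> R) : plane -> R :=
  expL N alpha (- t) (nonlin N (expL N alpha t V)).

Definition rk4_step (N : nat) (alpha dt t : R) (V : plane -> R) : plane -> R :=
  let k1 x := dt * rhsF N alpha t V x in
  let k2 x := dt * rhsF N alpha (t + dt / 2) (fun y => V y + k1 y / 2) x in
  let k3 x := dt * rhsF N alpha (t + dt / 2) (fun y => V y + k2 y / 2) x in
  let k4 x := dt * rhsF N alpha (t + dt) (fun y => V y + k3 y) x in
  fun x => V x + 6^-1 * (k1 x + 2 * k2 x + 2 * k3 x + k4 x).

Fixpoint ifrk4 (N : nat) (alpha dt : R) (u0 : plane -> R) (n : nat) :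
    plane -> R :=
  if n is n'.+1
  then rk4_step N alpha dt (n'%:R * dt) (ifrk4 N alpha dt u0 n')
  else PiN N u0.

Definition fully_discrete (N : nat) (alpha dt : R) (u0 : plane -> R) (n : nat) :
    plane -> R :=
  expL N alpha (n%:R * dt) (ifrk4 N alpha dt u0 n).

End FourierGalerkin.

(* Main.v *)
Require Import Defs.
From HB Require Import structures.
From mathcomp Require Import all_boot all_order all_algebra.
From mathcomp Require Import complex zify ring lra.
From mathcomp Require Import all_classical all_reals all_analysis.

(**
  The scheme is consistent of order four and the exact Galerkin flow is stable
  in [L^2], both uniformly in [N]; the two facts combine without any stability
  property of the scheme itself. With [w n] the exact solution that starts from
  the n-th numerical value, the error at step [n.+1] is the difference of two
  exact solutions, [uN] and [w n], plus the local error of one step. The first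
  part grows from the error at step [n] by a factor [exp (kappa dt)]
  ([tsol_stability]) and the second is of order [dt ^ 5]
  ([tsol_local_error]); summing over the steps gives order four
  ([ifrk4_coef_convergence]). The assumed Sobolev bounds on [uN] and on every
  [w n] make all constants uniform.

  Everything is done on Fourier coefficients. An element of [XN N] is the sum of
  its Fourier series, projections are truncations, and the [L^2] norm is the
  l^2 norm of the coefficients. The coefficients of a solution are discrete
  Fourier transforms of finitely many of its point values, hence differentiable
  in time, and testing the weak equation with its own residual shows that they
  solve an ordinary differential equation
  [y' = i ell y + i c (y * y)], where [y * y] is a truncated convolution
  ([semidiscrete_tsol]).

  Regularity is measured by weighted Wiener norms [sum_k W k ^ p |y k|], where
  the weight [W k = (2 (1 + |k|^2)) ^ ((1 + alpha) / 2)] is submultiplicative and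
  dominates the symbols of the linear and of the nonlinear part. These norms
  are algebra norms, and each time derivative costs one level. Five levels are
  available because [q - 2 > 5 (1 + alpha)] for [alpha <= 2]
  ([wnorm_Hnorm]), so the solution has five bounded time derivatives, also after
  multiplication by the integrating factor.

  For the local error let [y] be the exact solution in the integrating-factor
  variable. If all slopes were evaluated on [y], the scheme would be Simpson's
  rule for [y'], with an error of order five. The stages are evaluated at
  arguments that differ from [y] by [e2], [e3], [e4], which perturbs the slopes
  by [d2], [d3], [d4]. Since the nonlinearity is quadratic, these are explicit,
  and expanding [y] by Taylor's formula shows that [2 d2 + 2 d3 + d4] is of
  order four. The estimates are written with a calculus of orders
  ([bigO]) that keeps track of the power of the step and of the level, with
  constants uniform over all truncations, times and solutions.

  For stability, the linear part is skew-adjoint, and in the transport term the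
  symmetrization of the trilinear sum moves the derivative from the difference
  to the sum of the two solutions ([energy_transport]).
*)

Set Implicit Arguments.
Unset Strict Implicit.
Unset Printing Implicit Defensive.

Import Order.TTheory GRing.Theory Num.Theory.
Import numFieldNormedType.Exports.
Import ComplexField.Normc.

Local Open Scope classical_set_scope.
Local Open Scope ring_scope.
Local Open Scope complex_scope.

Local Notation cn := ComplexField.Normc.normc.
Local Notation cRe := complex.Re.
Local Notation cIm := complex.Im.

(** * Moduli and phases of complex numbers *)

Section Modulus.
Variable R : realType.
Implicit Types (x y z : R[i]) (r : R).

Lemma complexP x y : cRe x = cRe y -> cIm x = cIm y -> x = y.
Proof. by case: x y => [? ?] [? ?] /= -> ->. Qed.

Lemma cReD x y : cRe (x + y) = cRe x + cRe y. Proof. by case: x y => [? ?] []. Qed.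
Lemma cImD x y : cIm (x + y) = cIm x + cIm y. Proof. by case: x y => [? ?] []. Qed.
Lemma cReN x : cRe (- x) = - cRe x. Proof. by case: x. Qed.
Lemma cImN x : cIm (- x) = - cIm x. Proof. by case: x. Qed.
Lemma cReM x y : cRe (x * y) = cRe x * cRe y - cIm x * cIm y.
Proof. by case: x y => [? ?] []. Qed.
Lemma cImM x y : cIm (x * y) = cRe x * cIm y + cIm x * cRe y.
Proof. by case: x y => [? ?] []. Qed.
Lemma cReJ x : cRe (conjc x) = cRe x. Proof. by case: x. Qed.
Lemma cImJ x : cIm (conjc x) = - cIm x. Proof. by case: x. Qed.

Lemma cJD x y : conjc (x + y) = conjc x + conjc y. Proof. exact: (rmorphD (@conjc R)). Qed.
Lemma cJM x y : conjc (x * y) = conjc x * conjc y. Proof. exact: (rmorphM (@conjc R)). Qed.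

Lemma cJ_real r : conjc (r%:C) = r%:C. Proof. exact: conjc_real. Qed.
Lemma cJ_nat n : conjc (n%:R : R[i]) = n%:R. Proof. exact: conjc_nat. Qed.
Lemma cJK x : conjc (conjc x) = x. Proof. exact: conjcK. Qed.

Lemma cJi : conjc ('i%R : R[i]) = - 'i%R. Proof. by apply: complexP; rewrite /= ?oppr0. Qed.

Lemma cJ_sum (I : Type) (s : seq I) (f : I -> R[i]) :
  conjc (\sum_(i <- s) f i) = \sum_(i <- s) conjc (f i).
Proof. exact: (rmorph_sum (@conjc R)). Qed.

Lemma cRe_sum (I : Type) (s : seq I) (f : I -> R[i]) :
  cRe (\sum_(i <- s) f i) = \sum_(i <- s) cRe (f i).
Proof.
by elim: s => [|i s IH]; rewrite ?big_nil // !big_cons cReD IH.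
Qed.

Lemma cIm_sum (I : Type) (s : seq I) (f : I -> R[i]) :
  cIm (\sum_(i <- s) f i) = \sum_(i <- s) cIm (f i).
Proof.
by elim: s => [|i s IH]; rewrite ?big_nil // !big_cons cImD IH.
Qed.

Lemma real_complexS (I : Type) (s : seq I) (f : I -> R) :
  (\sum_(i <- s) f i)%:C = \sum_(i <- s) (f i)%:C.
Proof. exact: (rmorph_sum (real_complex R)). Qed.

Lemma cn_ge0 x : 0 <= cn x.
Proof. by case: x => a b; exact: sqrtr_ge0. Qed.

Lemma cn_real r : cn (r%:C) = `|r|.
Proof. by rewrite /= expr0n addr0 sqrtr_sqr. Qed.

Lemma cnJ x : cn (conjc x) = cn x.
Proof. by case: x => a b /=; rewrite sqrrN. Qed.

Lemma cnB x y : cn (x - y) = cn (y - x).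
Proof. by rewrite -normcN opprB. Qed.

Lemma cn_sqr x : cn x ^+ 2 = cRe x ^+ 2 + cIm x ^+ 2.
Proof. by case: x => a b; rewrite sqr_sqrtr ?addr_ge0 ?sqr_ge0. Qed.

Lemma cn_mulJ x : x * conjc x = (cn x ^+ 2)%:C.
Proof.
by apply: complexP; rewrite ?cReM ?cImM ?cReJ ?cImJ cn_sqr /=; ring.
Qed.

Lemma cRe_le x : `|cRe x| <= cn x.
Proof.
by rewrite -(ler_pXn2r (n := 2)) ?nnegrE ?cn_ge0 ?normr_ge0 // cn_sqr real_normK ?num_real // lerDl sqr_ge0.
Qed.

Lemma cn_sum (I : Type) (s : seq I) (f : I -> R[i]) :
  cn (\sum_(i <- s) f i) <= \sum_(i <- s) cn (f i).
Proof.
elim: s => [|i s IH]; first by rewrite !big_nil normc0.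
by rewrite !big_cons (le_trans (le_normcD _ _)) // lerD2l.
Qed.

(** Linear functionals of norm at most one recover the modulus; this turns
    vector-valued mean value estimates into scalar ones. *)
Lemma cn_dual z : exists2 u, cn u <= 1 & cRe (u * z) = cn z.
Proof.
have [z0|z0] := eqVneq z 0.
  by exists 0; rewrite ?normc0 // z0 mulr0 normc0.
exists (conjc z * ((cn z)^-1)%:C).
  by rewrite normcM cnJ cn_real ger0_norm ?invr_ge0 ?cn_ge0 // mulfV //; apply: contra_neq z0 => /eq0_normc.
rewrite mulrAC [conjc z * z]mulrC cn_mulJ -rmorphM /= expr2 -mulrA mulfV ?mulr1 //.
by apply: contra_neq z0 => /eq0_normc.
Qed.

Definition cis r : R[i] := cos r +i* sin r.

Lemma Cexp_i r : Cexp ('i * r%:C) = cis r.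
Proof.
have -> : 'i * r%:C = 0 +i* r by apply: complexP; rewrite /=; ring.
by rewrite /Cexp /cis /= expR0 mul1r.
Qed.

Lemma cisD r s : cis (r + s) = cis r * cis s.
Proof. by apply: complexP; rewrite /= ?cosD ?sinD //; ring. Qed.

Lemma cis0 : cis 0 = 1.
Proof. by rewrite /cis cos0 sin0. Qed.

Lemma cisN r : cis (- r) = conjc (cis r).
Proof. by apply: complexP; rewrite /= ?cosN ?sinN. Qed.

Lemma cn_cis r : cn (cis r) = 1.
Proof. by rewrite /= cos2Dsin2 sqrtr1. Qed.

End Modulus.

(** * Primitives on a closed interval *)

Section Primitive.
Variables (R : realType) (a b : R).

(** [f] is a primitive of [df] on [[a, b]]: continuous up to the end points,
    differentiable inside, exactly what the mean value theorem asks for. *)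
Definition rder (f df : R -> R) : Prop :=
  {within `[a, b], continuous f} /\
  forall t, t \in `]a, b[ -> is_derive t 1 f (df t).

Lemma rder_ext f g df dg : f =1 g -> (forall t, t \in `]a, b[ -> df t = dg t) ->
  rder f df -> rder g dg.
Proof.
move=> /funext -> e [cg dg']; split => // t tab.
by rewrite -e //; exact: dg'.
Qed.

Lemma rder_cst c : rder (fun=> c) (fun=> 0).
Proof. by split; [by apply: continuous_subspaceT => x; exact: cst_continuous|move=> t _; exact: is_derive_cst]. Qed.

Lemma rderD f g df dg : rder f df -> rder g dg ->
  rder (fun t => f t + g t) (fun t => df t + dg t).
Proof.
move=> [cf df'] [cg dg']; split; last by move=> t tab; apply: is_deriveD; [exact: df'|exact: dg'].
by move=> x; apply: cvgD; [exact: cf|exact: cg].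
Qed.

Lemma rderM f g df dg : rder f df -> rder g dg ->
  rder (fun t => f t * g t) (fun t => df t * g t + f t * dg t).
Proof.
move=> [cf df'] [cg dg']; split; last first.
  move=> t tab; have := is_deriveM (df' t tab) (dg' t tab).
  by move=> H; apply: (is_derive_eq H); rewrite /GRing.scale /= addrC [g t * _]mulrC.
by move=> x; apply: cvgM; [exact: cf|exact: cg].
Qed.

Lemma rderZ c f df : rder f df -> rder (fun t => c * f t) (fun t => c * df t).
Proof.
move=> H; apply: rder_ext (rderM (rder_cst c) H) => // t _.
by rewrite mul0r add0r.
Qed.

Lemma rderN f df : rder f df -> rder (fun t => - f t) (fun t => - df t).
Proof.
by move=> H; apply: rder_ext (rderZ (-1) H) => t; rewrite mulN1r.
Qed.

Lemma rder_sum (I : eqType) (s : seq I) (f df : I -> R -> R) :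
  (forall i, i \in s -> rder (f i) (df i)) ->
  rder (fun t => \sum_(i <- s) f i t) (fun t => \sum_(i <- s) df i t).
Proof.
elim: s => [|i s IH] H.
  by apply: rder_ext (rder_cst 0) => t; rewrite ?big_nil.
apply: rder_ext (rderD (H i (mem_head _ _)) (IH _)) => [t|t _|j js]; rewrite ?big_cons //.
by apply: H; rewrite inE js orbT.
Qed.

Lemma rder_global f df : (forall t : R, is_derive t 1 f (df t)) -> rder f df.
Proof.
move=> H; split => // ; apply: continuous_subspaceT => x.
have [d _] := H x.
exact/differentiable_continuous/derivable1_diffP.
Qed.

End Primitive.

Section MeanValue.
Variables (R : realType).
Implicit Types (a b K : R).

Lemma rder_sub a b a' b' (f df : R -> R) : a <= a' -> b' <= b ->
  rder a b f df -> rder a' b' f df.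
Proof.
move=> aa bb [cf H]; split.
  apply: continuous_subspaceW cf => x; rewrite /= !in_itv /= => /andP[h1 h2].
  by rewrite (le_trans aa h1) (le_trans h2 bb).
move=> t; rewrite in_itv /= => /andP[h1 h2]; apply: H.
by rewrite in_itv /= (le_lt_trans aa h1) (lt_le_trans h2 bb).
Qed.

Lemma rder_bound a b (f df : R -> R) K t : a <= t -> t <= b ->
  rder a b f df -> (forall s, a <= s <= t -> `|df s| <= K) ->
  `|f t - f a| <= K * (t - a).
Proof.
move=> at_ tb /(rder_sub (lexx a) tb) [cf H] bd.
have [c] := MVT_segment at_ H cf.
rewrite in_itv /= => cab ->.
rewrite normrM ler_pM //; first exact: bd.
by rewrite ger0_norm // subr_ge0.
Qed.

Lemma rder_mono a b (f df : R -> R) : a <= b ->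
  rder a b f df -> (forall s, a < s < b -> df s <= 0) -> f b <= f a.
Proof.
rewrite le_eqVlt => /predU1P[-> //|ab] [cf H] bd.
have [c] := MVT ab H cf.
rewrite in_itv /= => cab e.
rewrite -subr_le0 e; apply: mulr_le0_ge0; first exact: bd.
by rewrite subr_ge0 ltW.
Qed.

Lemma is_derive_taylor_monomial (a : R) n (t : R) :
  is_derive t 1 (fun s => (s - a) ^+ n.+1 / n.+1`!%:R) ((t - a) ^+ n / n`!%:R).
Proof.
have H : is_derive t 1 (fun s : R => s - a) (1 - 0).
  by apply: is_deriveB; exact: is_derive_cst.
have -> : (fun s => (s - a) ^+ n.+1 / n.+1`!%:R) =
  (fun s : R => s - a) ^+ n.+1 * cst (n.+1`!%:R^-1).
  by apply/funext => s; rewrite mulrfctE /= exprfctE.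
have D := is_deriveM (is_deriveX n.+1 H) (is_derive_cst (n.+1`!%:R^-1 : R) t 1).
apply: (is_derive_eq D).
rewrite /GRing.scale /= mulr0 add0r subr0 mulr1 factS natrM.
have h1 : n.+1%:R != 0 :> R by rewrite pnatr_eq0.
have h2 : n`!%:R != 0 :> R by rewrite pnatr_eq0 -lt0n fact_gt0.
move: h1 h2; move: (n.+1%:R : R) (n`!%:R : R) ((t - a) ^+ n) => x y z x0 y0.
by rewrite /= invfM mulrC mulrACA mulfV // mul1r.
Qed.

Lemma rder_taylor_monomial (a b : R) n :
  rder a b (fun s => (s - a) ^+ n.+1 / n.+1`!%:R) (fun s => (s - a) ^+ n / n`!%:R).
Proof. by apply: rder_global => t; exact: is_derive_taylor_monomial. Qed.

(** Repeated use of the mean value theorem: each derivative of the Taylor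
    remainder is the remainder of the next derivative, and vanishes at [a]. *)
Lemma rder_taylor a b (g : nat -> R -> R) m K t : a <= t -> t <= b -> 0 <= K ->
  (forall i, (i < m)%N -> rder a b (g i) (g i.+1)) ->
  (forall s, a <= s <= b -> `|g m s| <= K) ->
  `|g 0 t - \sum_(i < m) g i a * ((t - a) ^+ i / i`!%:R)| <= K * (t - a) ^+ m.
Proof.
move=> + + K0; elim: m g t => [|m IH] g t at_ tb H bd.
  by rewrite big_ord0 subr0 expr0 mulr1 bd // at_.
have {}IH s : a <= s <= t -> _ := fun h => IH (fun i => g i.+1) s
  (proj1 (andP h)) (le_trans (proj2 (andP h)) tb) (fun i im => H i.+1 im) bd.
pose r s := g 0 s - \sum_(i < m.+1) g i a * ((s - a) ^+ i / i`!%:R).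
pose dr s := g 1 s - \sum_(i < m) g i.+1 a * ((s - a) ^+ i / i`!%:R).
have Hr : rder a b r dr.
  apply: rderD; first exact: H.
  apply: rderN.
  have Hs := rder_sum (s := index_enum 'I_m) (fun i _ =>
     rderZ (g (nat_of_ord i).+1 a) (rder_taylor_monomial a b i)).
  apply: rder_ext (rderD (rder_cst a b (g 0 a)) Hs) => s /=; last by rewrite add0r.
  by rewrite big_ord_recl /= expr0 fact0 divr1 mulr1.
have r0 : r a = 0.
  rewrite /r big_ord_recl /= expr0 fact0 divr1 mulr1 big1 ?addr0 ?subrr // => i _.
  by rewrite ?subrr expr0n /= mul0r mulr0.
rewrite -/(r t) -[r t]subr0 -r0 exprSr mulrA.
apply: (rder_bound at_ tb Hr) => s ast; apply: le_trans (IH s ast) _.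
rewrite ler_wpM2l // lerXn2r ?nnegrE ?subr_ge0 ?lerD2r //; by case/andP: ast.
Qed.

End MeanValue.

Section ComplexPrimitive.
Variables (R : realType) (a b : R).
Implicit Types (f g df dg : R -> R[i]).

Definition cder f df : Prop :=
  rder a b (fun t => cRe (f t)) (fun t => cRe (df t)) /\
  rder a b (fun t => cIm (f t)) (fun t => cIm (df t)).

Lemma cder_ext f g df dg : f =1 g -> (forall t, t \in `]a, b[ -> df t = dg t) ->
  cder f df -> cder g dg.
Proof.
move=> e e' [h1 h2]; split; [apply: rder_ext h1|apply: rder_ext h2] => t.
- by rewrite e.
- by move=> /e' ->.
- by rewrite e.
- by move=> /e' ->.
Qed.

Lemma cder_cst (c : R[i]) : cder (fun=> c) (fun=> 0).
Proof. by split; exact: rder_cst. Qed.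

Lemma cderD f g df dg : cder f df -> cder g dg ->
  cder (fun t => f t + g t) (fun t => df t + dg t).
Proof.
move=> [f1 f2] [g1 g2]; split.
  by apply: rder_ext (rderD f1 g1) => t; rewrite cReD.
by apply: rder_ext (rderD f2 g2) => t; rewrite cImD.
Qed.

Lemma cderM f g df dg : cder f df -> cder g dg ->
  cder (fun t => f t * g t) (fun t => df t * g t + f t * dg t).
Proof.
move=> [f1 f2] [g1 g2]; split.
  apply: rder_ext (rderD (rderM f1 g1) (rderN (rderM f2 g2))) => t; rewrite ?cReD !cReM //.
  by move=> _; ring.
apply: rder_ext (rderD (rderM f1 g2) (rderM f2 g1)) => t; rewrite ?cImD !cImM //.
by move=> _; ring.
Qed.

Lemma cderZ (c : R[i]) f df : cder f df -> cder (fun t => c * f t) (fun t => c * df t).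
Proof.
move=> H; apply: cder_ext (cderM (cder_cst c) H) => // t _.
by rewrite mul0r add0r.
Qed.

Lemma cder_sum (I : eqType) (s : seq I) (f df : I -> R -> R[i]) :
  (forall i, i \in s -> cder (f i) (df i)) ->
  cder (fun t => \sum_(i <- s) f i t) (fun t => \sum_(i <- s) df i t).
Proof.
elim: s => [|i s IH] H.
  by apply: cder_ext (cder_cst 0) => t; rewrite ?big_nil.
apply: cder_ext (cderD (H i (mem_head _ _)) (IH _)) => [t|t _|j js]; rewrite ?big_cons //.
by apply: H; rewrite inE js orbT.
Qed.

Lemma cder_cis (c : R) : cder (fun t => cis (t * c)) (fun t => 'i * c%:C * cis (t * c)).
Proof.
have D (t : R) : is_derive t 1 (fun s : R => s * c) c.
  have := is_deriveM (is_derive_id t (1 : R)) (is_derive_cst c t 1).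
  by move=> H; apply: (is_derive_eq H); rewrite /GRing.scale /= mulr0 add0r mulr1.
split; apply: rder_global => t.
  have H := @is_derive1_comp _ cos (fun s : R => s * c) t _ _ (is_derive_cos (t * c)) (D t); apply: (is_derive_eq H).
  by rewrite !cReM !cImM /=; ring.
have H := @is_derive1_comp _ sin (fun s : R => s * c) t _ _ (is_derive_sin (t * c)) (D t); apply: (is_derive_eq H).
by rewrite cImM cReM cImM /=; ring.
Qed.

Lemma rder_cReM (c : R[i]) f df : cder f df ->
  rder a b (fun t => cRe (c * f t)) (fun t => cRe (c * df t)).
Proof. by move=> /(cderZ c)[]. Qed.

Lemma rder_cn_sqr f df : cder f df ->
  rder a b (fun t => cn (f t) ^+ 2) (fun t => 2 * cRe (conjc (f t) * df t)).
Proof.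
move=> [h1 h2].
apply: rder_ext (rderD (rderM h1 h1) (rderM h2 h2)) => t; first by rewrite cn_sqr; ring.
by move=> _; rewrite cReM cReJ cImJ; ring.
Qed.

End ComplexPrimitive.

Lemma cder_sub (R : realType) (a b a' b' : R) (f df : R -> R[i]) :
  a <= a' -> b' <= b -> cder a b f df -> cder a' b' f df.
Proof. by move=> h1 h2 [f1 f2]; split; [exact: rder_sub f1|exact: rder_sub f2]. Qed.


(** The product [expR (- K * t) * E t] is nonincreasing. *)
Lemma rder_gronwall (R : realType) (a b K : R) (E dE : R -> R) : a <= b ->
  rder a b E dE -> (forall t, a < t < b -> dE t <= K * E t) ->
  E b <= expR (K * (b - a)) * E a.
Proof.
move=> ab HE bd.
have D (t : R) : is_derive t 1 (fun s : R => expR (- K * s)) (- K * expR (- K * t)).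
  have H : is_derive t 1 (fun s : R => - K * s) (- K).
    have := is_deriveM (is_derive_cst (- K) t (1 : R)) (is_derive_id t (1 : R)).
    by move=> H; apply: (is_derive_eq H); rewrite /GRing.scale /= mulr0 addr0 mulr1.
  have He := @is_derive1_comp _ expR (fun s : R => - K * s) t _ _ (is_derive_expR (- K * t)) H; apply: (is_derive_eq He).
  by rewrite mulrC.
have H := rderM (rder_global a b D) HE.
have le : expR (- K * b) * E b <= expR (- K * a) * E a.
  apply: (rder_mono ab H) => s sab.
  have -> : - K * expR (- K * s) * E s + expR (- K * s) * dE s =
    expR (- K * s) * (dE s - K * E s) by ring.
  by rewrite pmulr_rle0 ?expR_gt0 // subr_le0 bd.
have : expR (K * b) * (expR (- K * b) * E b) <= expR (K * b) * (expR (- K * a) * E a).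
  by rewrite ler_pM2l ?expR_gt0.
rewrite !mulrA -!expRD.
have -> : K * b + - K * b = 0 by ring.
have -> : K * b + - K * a = K * (b - a) by ring.
by rewrite expR0 mul1r.
Qed.

(** * Weighted Wiener norms and truncated convolution *)

Section Wiener.
Variables (R : realType) (I : zmodType) (F : seq I) (W : I -> R).
Hypothesis F_uniq : uniq F.
Hypothesis W_ge1 : forall k, 1 <= W k.
Hypothesis WD : forall j l, W (j + l) <= W j * W l.

Local Notation E := (I -> R[i]).
Implicit Types (f g h : E) (p m : nat).

(** The weighted Wiener norm of level [p]: one power of [W] stands for the
    smoothness lost in one application of the equation. *)
Definition wnorm p f : R := \sum_(k <- F) W k ^+ p * cn (f k).

(** The coefficients of the product of two trigonometric polynomials with
    frequencies in [F]. *)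
Definition tconv f g : E := fun k =>
  \sum_(j <- F) \sum_(l <- F) (j + l == k)%:R * (f j * g l).

Lemma W_ge0 k : 0 <= W k. Proof. exact: le_trans (W_ge1 k). Qed.

Lemma WX_ge0 k p : 0 <= W k ^+ p. Proof. by rewrite exprn_ge0 // W_ge0. Qed.

Lemma wnorm_ge0 p f : 0 <= wnorm p f.
Proof. by apply: sumr_ge0 => k _; rewrite mulr_ge0 ?WX_ge0 ?cn_ge0. Qed.

Lemma ler_wnorm p f g : (forall k, k \in F -> cn (f k) <= cn (g k)) ->
  wnorm p f <= wnorm p g.
Proof.
move=> H; rewrite /wnorm !big_seq; apply: ler_sum => k kF.
by rewrite ler_wpM2l ?WX_ge0 ?H.
Qed.

Lemma eq_wnorm p f g : (forall k, k \in F -> f k = g k) -> wnorm p f = wnorm p g.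
Proof. by move=> H; apply/eqP; rewrite eq_le !ler_wnorm // => k /H ->. Qed.

Lemma wnorm_lvl p p' f : (p <= p')%N -> wnorm p f <= wnorm p' f.
Proof.
move=> pp; apply: ler_sum => k _; rewrite ler_wpM2r ?cn_ge0 //.
exact: ler_weXn2l.
Qed.

Lemma wnormD p f g : wnorm p (fun k => f k + g k) <= wnorm p f + wnorm p g.
Proof.
rewrite -big_split /=; apply: ler_sum => k _; rewrite -mulrDr ler_wpM2l ?WX_ge0 //.
exact: le_normcD.
Qed.

Lemma wnormZ p (c : R) f : wnorm p (fun k => c%:C * f k) = `|c| * wnorm p f.
Proof. by rewrite mulr_sumr; apply: eq_bigr => k _; rewrite normcM cn_real mulrCA. Qed.

(** A Fourier multiplier dominated by the weight costs one level. *)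
Lemma wnorm_mult p (d : E) f : (forall k, cn (d k) <= W k) ->
  wnorm p (fun k => d k * f k) <= wnorm p.+1 f.
Proof.
move=> H; apply: ler_sum => k _.
by rewrite normcM exprSr -mulrA ler_wpM2l ?WX_ge0 // ler_wpM2r ?cn_ge0.
Qed.

Lemma wnorm_cis p (c : I -> R) f : wnorm p (fun k => cis (c k) * f k) = wnorm p f.
Proof. by apply: eq_bigr => k _; rewrite normcM cn_cis mul1r. Qed.

Lemma cn_le_wnorm p f k : k \in F -> cn (f k) <= wnorm p f.
Proof.
move=> kF; rewrite /wnorm (big_rem k) //= -[X in X <= _]addr0 lerD //.
  by rewrite -[X in X <= _]mul1r ler_wpM2r ?cn_ge0 // exprn_ege1.
by apply: sumr_ge0 => i _; rewrite mulr_ge0 ?WX_ge0 ?cn_ge0.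
Qed.

Lemma sum_delta_le1 k : \sum_(i <- F) (k == i)%:R <= 1 :> R.
Proof.
have [kF|kF] := boolP (k \in F).
  rewrite (bigD1_seq k) //= eqxx big1 ?addr0 // => i /negPf.
  by rewrite eq_sym => ->.
rewrite big_seq big1 // => i iF; case: eqP => // e.
by rewrite e iF in kF.
Qed.

(** The weights are submultiplicative, so these norms are algebra norms;
    truncating the product can only decrease them. *)
Lemma wnorm_tconv p f g : wnorm p (tconv f g) <= wnorm p f * wnorm p g.
Proof.
have WM j l : W (j + l) ^+ p <= W j ^+ p * W l ^+ p.
  by rewrite -exprMn lerXn2r ?nnegrE ?mulr_ge0 ?W_ge0.
pose T j l k := (j + l == k)%:R * ((W j ^+ p * cn (f j)) * (W l ^+ p * cn (g l))).
have -> : wnorm p f * wnorm p g =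
    \sum_(j <- F) \sum_(l <- F) (W j ^+ p * cn (f j)) * (W l ^+ p * cn (g l)).
  by rewrite mulr_suml; apply: eq_bigr => j _; rewrite mulr_sumr.
apply: (@le_trans _ _ (\sum_(k <- F) \sum_(j <- F) \sum_(l <- F) T j l k)).
  apply: ler_sum => k _.
  apply: le_trans (ler_wpM2l (WX_ge0 k p) (cn_sum _ _)) _.
  rewrite mulr_sumr; apply: ler_sum => j _.
  apply: le_trans (ler_wpM2l (WX_ge0 k p) (cn_sum _ _)) _.
  rewrite mulr_sumr; apply: ler_sum => l _; rewrite /T.
  case: eqP => [<-|_]; last by rewrite !mul0r normc0 mulr0.
  rewrite !mul1r normcM mulrACA; apply: ler_wpM2r; first by rewrite mulr_ge0 ?cn_ge0.
  exact: WM.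
rewrite exchange_big /=; apply: ler_sum => j _.
rewrite exchange_big /=; apply: ler_sum => l _.
rewrite -mulr_suml -[X in _ <= X]mul1r ler_wpM2r ?sum_delta_le1 //.
by rewrite !mulr_ge0 ?WX_ge0 ?cn_ge0.
Qed.

Lemma tconvDl f f' g k : tconv (fun j => f j + f' j) g k = tconv f g k + tconv f' g k.
Proof.
rewrite /tconv -big_split /=; apply: eq_bigr => j _; rewrite -big_split /=.
by apply: eq_bigr => l _; rewrite mulrDl mulrDr.
Qed.

Lemma tconvZl (c : R[i]) f g k : tconv (fun j => c * f j) g k = c * tconv f g k.
Proof.
rewrite /tconv mulr_sumr; apply: eq_bigr => j _; rewrite mulr_sumr.
by apply: eq_bigr => l _; ring.
Qed.

Lemma tconvC f g k : tconv f g k = tconv g f k.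
Proof.
rewrite /tconv exchange_big; apply: eq_bigr => j _; apply: eq_bigr => l _.
by rewrite addrC [g _ * _]mulrC.
Qed.

Lemma eq_tconv f f' g g' k : (forall j, j \in F -> f j = f' j) ->
  (forall j, j \in F -> g j = g' j) -> tconv f g k = tconv f' g' k.
Proof.
move=> ef eg; rewrite /tconv !big_seq; apply: eq_bigr => j jF.
by rewrite !big_seq; apply: eq_bigr => l lF; rewrite ef ?eg.
Qed.

Section Regularity.
Variables (a b : R).
Implicit Types (y dy : R -> E) (K : R).

Definition edot y dy := forall k, k \in F -> cder a b (fun t => y t k) (fun t => dy t k).

(** [y] has [m] derivatives in time, the [i]-th one bounded by [K] at level
    [m + p - i]: every time derivative costs one level of smoothness. *)
Fixpoint creg m p K y : Prop :=
  (forall t, a <= t <= b -> wnorm (m + p) (y t) <= K) /\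
  if m is m'.+1 then exists2 dy, edot y dy & creg m' p K dy else True.

Lemma creg_bound m p K y : creg m p K y ->
  forall t, a <= t <= b -> wnorm (m + p) (y t) <= K.
Proof. by case: m => [|m] []. Qed.

Lemma creg_weaken m p K K' y : K <= K' -> creg m p K y -> creg m p K' y.
Proof.
move=> KK; elim: m y => [|m IH] y [H H']; split => //.
- by move=> t tab; apply: le_trans (H t tab) KK.
- by move=> t tab; apply: le_trans (H t tab) KK.
- by case: H' => dy h1 h2; exists dy => //; exact: IH.
Qed.

Lemma creg_lvl m p K y : creg m p.+1 K y -> creg m p K y.
Proof.
elim: m y => [|m IH] y [H H']; split => //.
- by move=> t tab; apply: le_trans (H t tab); exact: wnorm_lvl.
- by move=> t tab; apply: le_trans (H t tab); apply: wnorm_lvl; rewrite addnS.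
- by case: H' => dy h1 h2; exists dy => //; exact: IH.
Qed.

Lemma creg_trunc m p K y : creg m.+1 p K y -> creg m p.+1 K y.
Proof.
elim: m y => [|m IH] y [H [dy h1 h2]]; first by split.
split; first by move=> t tab; rewrite addnS; exact: H.
by exists dy => //; exact: IH.
Qed.

Lemma cregD m p K K' y z : creg m p K y -> creg m p K' z ->
  creg m p (K + K') (fun t k => y t k + z t k).
Proof.
elim: m y z => [|m IH] y z [H H'] [G G']; split => //.
- by move=> t tab; apply: le_trans (wnormD _ _ _) _; rewrite lerD ?H ?G.
- by move=> t tab; apply: le_trans (wnormD _ _ _) _; rewrite lerD ?H ?G.
case: H' G' => dy h1 h2 [dz g1 g2].
exists (fun t k => dy t k + dz t k); last exact: IH.
by move=> k kF; apply: cderD; [exact: h1|exact: g1].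
Qed.

Lemma edot_tconv y dy z dz : edot y dy -> edot z dz ->
  edot (fun t => tconv (y t) (z t)) (fun t k => tconv (dy t) (z t) k + tconv (y t) (dz t) k).
Proof.
move=> Hy Hz k _.
have H : cder a b (fun t => tconv (y t) (z t) k)
   (fun t => \sum_(j <- F) \sum_(l <- F) (j + l == k)%:R * (dy t j * z t l + y t j * dz t l)).
  apply: cder_sum => j jF; apply: cder_sum => l lF; apply: cderZ.
  by apply: cderM; [exact: Hy|exact: Hz].
apply: cder_ext H => // t _.
rewrite /tconv -big_split /=; apply: eq_bigr => j _; rewrite -big_split /=.
by apply: eq_bigr => l _; rewrite mulrDr.
Qed.

(** Leibniz' rule; each derivative of a product doubles the number of terms. *)
Lemma creg_tconv m p K K' y z : 0 <= K -> 0 <= K' ->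
  creg m p K y -> creg m p K' z ->
  creg m p (2 ^+ m * (K * K')) (fun t => tconv (y t) (z t)).
Proof.
move=> K0 K0'.
have bd q t y' z' : wnorm q (y' t) <= K -> wnorm q (z' t) <= K' ->
    wnorm q (tconv (y' t) (z' t)) <= K * K'.
  by move=> h1 h2; apply: le_trans (wnorm_tconv _ _ _) _; rewrite ler_pM ?wnorm_ge0.
elim: m y z => [|m IH] y z Hy Hz.
  by split=> // t tab; rewrite expr0 mul1r bd ?(creg_bound Hy) ?(creg_bound Hz).
split.
  move=> t tab; apply: le_trans (bd _ _ _ _ (creg_bound Hy tab) (creg_bound Hz tab)) _.
  by rewrite -[X in X <= _]mul1r ler_wpM2r ?mulr_ge0 // exprn_ege1 // ler1n.
have [_ [dy h1 h2]] := Hy; have [_ [dz g1 g2]] := Hz.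
exists (fun t k => tconv (dy t) (z t) k + tconv (y t) (dz t) k); first exact: edot_tconv.
have -> : 2 ^+ m.+1 * (K * K') = 2 ^+ m * (K * K') + 2 ^+ m * (K * K') by rewrite exprS; ring.
by apply: cregD; apply: IH => //; apply/creg_lvl/creg_trunc.
Qed.

Lemma creg_mult m p K (d : E) y : (forall k, cn (d k) <= W k) ->
  creg m p.+1 K y -> creg m p K (fun t k => d k * y t k).
Proof.
move=> dW; elim: m y => [|m IH] y [H H']; split => //.
- by move=> t tab; apply: le_trans (wnorm_mult _ _ dW) _; exact: H.
- by move=> t tab; apply: le_trans (wnorm_mult _ _ dW) _; rewrite -addnS; exact: H.
case: H' => dy h1 h2; exists (fun t k => d k * dy t k); last exact: IH.
by move=> k kF; apply: cderZ; exact: h1.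
Qed.

Lemma cn_imul (ell : I -> R) k : `|ell k| <= W k -> cn ('i * (ell k)%:C) <= W k.
Proof. by rewrite normcM cn_real /= expr0n add0r expr1n sqrtr1 mul1r. Qed.

(** Conjugating with the unitary group [cis (t * ell)] keeps the regularity:
    its time derivative is a multiplier costing one level. *)
Lemma creg_cis m p K (ell : I -> R) y : (forall k, `|ell k| <= W k) -> 0 <= K ->
  creg m p K y -> creg m p (2 ^+ m * K) (fun t k => cis (t * ell k) * y t k).
Proof.
move=> eW; elim: m K y => [|m IH] K y K0 [H H']; split => //.
- by move=> t tab; rewrite wnorm_cis expr0 mul1r; exact: H.
- move=> t tab; rewrite wnorm_cis; apply: le_trans (H t tab) _.
  by rewrite -[X in X <= _]mul1r ler_wpM2r // exprn_ege1 // ler1n.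
case: (H') => dy h1 h2.
exists (fun t k => cis (t * ell k) * ('i * (ell k)%:C * y t k + dy t k)).
  move=> k kF; apply: cder_ext (cderM (cder_cis a b (ell k)) (h1 k kF)) => // t _.
  by ring.
have -> : 2 ^+ m.+1 * K = 2 ^+ m * (K + K) by rewrite exprS; ring.
apply: IH; first by rewrite addr_ge0.
apply: cregD => //; apply: creg_mult => [k|]; first by rewrite cn_imul.
by apply: creg_trunc; split.
Qed.

(** The nested derivatives of [creg], as the sequence that Taylor's formula is
    stated for. *)
Lemma creg_derivatives m p K y dy : edot y dy -> creg m p K dy ->
  exists Y : nat -> R -> E, [/\ Y 0%N = y, Y 1%N = dy,
    forall i, (i <= m)%N -> edot (Y i) (Y i.+1) &
    forall i t, (i <= m)%N -> a <= t <= b -> wnorm (m + p - i) (Y i.+1 t) <= K].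
Proof.
elim: m y dy => [|m IH] y dy Hy Hdy.
  exists (fun i => if i is 0 then y else dy); split => // [[]|[]] // t _.
  by rewrite subn0; exact: creg_bound.
have [_ [ddy h1 h2]] := Hdy.
have [Y [Y0 Y1 YD Yb]] := IH dy ddy h1 h2.
exists (fun i => if i is i'.+1 then Y i' else y); split => //.
- by move=> [_|i]; [rewrite Y0|exact: YD].
- move=> [|i] t im tab; first by rewrite Y0 subn0; exact: creg_bound.
  by rewrite addSn subSS; exact: Yb.
Qed.

(** Taylor's formula at level [p], obtained from the scalar one by pairing
    with the unimodular coefficients that realize the norm of the remainder. *)
Lemma wnorm_taylor (Y : nat -> R -> E) m p K t : a <= t -> t <= b -> 0 <= K ->
  (forall i, (i < m)%N -> edot (Y i) (Y i.+1)) ->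
  (forall s, a <= s <= b -> wnorm p (Y m s) <= K) ->
  wnorm p (fun k => Y 0%N t k -
     \sum_(i < m) ((t - a) ^+ i / i`!%:R)%:C * Y i a k) <= K * (t - a) ^+ m.
Proof.
move=> at_ tb K0 YD Yb; set z := fun k => _ - _.
have [u u1 uz] : exists2 u : E, (forall k, cn (u k) <= 1) &
    forall k, cRe (u k * z k) = cn (z k).
  have /choice[u Hu] : forall k, exists u, cn u <= 1 /\ cRe (u * z k) = cn (z k).
    by move=> k; have [u h1 h2] := cn_dual (z k); exists u.
  by exists u => k; case: (Hu k).
pose g i s := \sum_(k <- F) W k ^+ p * cRe (u k * Y i s k).
have gD i : (i < m)%N -> rder a b (g i) (g i.+1).
  move=> im; apply: rder_sum => k kF; apply: rderZ; apply: rder_cReM.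
  exact: YD.
have gb s : a <= s <= b -> `|g m s| <= K.
  move=> sab; apply: le_trans (Yb s sab).
  apply: le_trans (ler_norm_sum _ _ _) _; apply: ler_sum => k _.
  rewrite normrM ger0_norm ?WX_ge0 // ler_wpM2l ?WX_ge0 //.
  apply: le_trans (cRe_le _) _; rewrite normcM.
  by rewrite -[X in _ <= X]mul1r ler_wpM2r ?cn_ge0.
apply: le_trans (rder_taylor at_ tb K0 gD gb).
have -> : wnorm p z = \sum_(k <- F) W k ^+ p * cRe (u k * z k).
  by apply: eq_bigr => k _; rewrite uz.
have -> : \sum_(k <- F) W k ^+ p * cRe (u k * z k) =
   g 0 t - \sum_(i < m) g i a * ((t - a) ^+ i / i`!%:R).
  rewrite /g; under [in X in _ - X]eq_bigr => i _ do rewrite mulr_suml.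
  rewrite exchange_big /= -sumrB; apply: eq_bigr => k _.
  under eq_bigr => i _ do rewrite -mulrA.
  rewrite -mulr_sumr -mulrBr; congr (_ * _).
  rewrite /z mulrBr cReD cReN; congr (_ - _).
  rewrite mulr_sumr cRe_sum; apply: eq_bigr => i _.
  by rewrite mulrCA cReM /= mul0r subr0 mulrC.
exact: ler_norm.
Qed.

End Regularity.
End Wiener.

(** * Local error of the Runge--Kutta method *)

Section Bilinear.
Variables (R : realType) (I : zmodType) (W : I -> R) (ell : I -> R) (d : I -> R[i]).
Hypothesis W_ge1 : forall k, 1 <= W k.
Hypothesis WD : forall j l, W (j + l) <= W j * W l.
Hypothesis ellW : forall k, `|ell k| <= W k.
Hypothesis dW : forall k, cn (d k) <= W k.

Local Notation E := (I -> R[i]).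

Definition phase s (f : E) : E := fun k => cis (s * ell k) * f k.

(** The nonlinearity seen through the integrating factor, polarized: the
    equation for [V = phase (- t) (y t)] has right-hand side [ifB F t V V]. *)
Definition ifB (F : seq I) s (f g : E) : E := fun k =>
  cis (- s * ell k) * (d k * tconv F (phase s f) (phase s g) k).

Definition ifrk4_coef (F : seq I) h s (V : E) : E :=
  let k1 k := h%:C * ifB F s V V k in
  let V2 k := V k + k1 k / 2 in
  let k2 k := h%:C * ifB F (s + h / 2) V2 V2 k in
  let V3 k := V k + k2 k / 2 in
  let k3 k := h%:C * ifB F (s + h / 2) V3 V3 k in
  let V4 k := V k + k3 k in
  let k4 k := h%:C * ifB F (s + h) V4 V4 k in
  fun k => V k + 6^-1 * (k1 k + 2 * k2 k + 2 * k3 k + k4 k).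

Lemma cis_lip (x y : R) : cn (cis x - cis y) <= `|x - y|.
Proof.
wlog xy : x y / y <= x.
  by move=> H; case: (leP y x) => [/H //|/ltW /H]; rewrite cnB distrC.
have [u u1 <-] := cn_dual (cis x - cis y).
rewrite mulrBr cReD cReN; apply: le_trans (ler_norm _) _.
have D := rder_cReM u (cder_cis y x 1).
have := rder_bound (K := 1) xy (lexx x) D.
rewrite !mulr1 mul1r [in X in _ -> X](ger0_norm (x := x - y)) ?subr_ge0 //.
apply=> s _; apply: le_trans (cRe_le _) _.
rewrite !normcM cn_cis !mulr1.
by rewrite [cn (_ +i* _)]/= expr0n add0r expr1n sqrtr1 mulr1.
Qed.

Section Estimates.
Variable F : seq I.
Hypothesis F_uniq : uniq F.
Implicit Types (f g : E) (p : nat) (s : R).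
Local Notation wn := (wnorm F W).
Local Notation B := (ifB F).

Lemma wnorm_phase p s f : wn p (phase s f) = wn p f.
Proof. exact: wnorm_cis. Qed.

Lemma wnorm_phase_lip p s s' f :
  wn p (fun k => phase s f k - phase s' f k) <= `|s - s'| * wn p.+1 f.
Proof.
rewrite /wnorm mulr_sumr; apply: ler_sum => k _.
rewrite /phase -mulrBl normcM.
have H : cn (cis (s * ell k) - cis (s' * ell k)) <= `|s - s'| * W k.
  by apply: le_trans (cis_lip _ _) _; rewrite -mulrBl normrM ler_wpM2l.
apply: le_trans (ler_wpM2l (WX_ge0 W_ge1 k p) (ler_wpM2r (cn_ge0 _) H)) _.
by rewrite exprSr le_eqVlt; apply/orP; left; apply/eqP; ring.
Qed.

Lemma wnorm_ifB p s f g : wn p (B s f g) <= wn p.+1 f * wn p.+1 g.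
Proof.
rewrite /ifB wnorm_cis; apply: le_trans (wnorm_mult _ W_ge1 _ _ dW) _.
by apply: le_trans (wnorm_tconv F_uniq W_ge1 WD _ _ _) _; rewrite !wnorm_phase.
Qed.

(** Time enters through three phases. Each of them is Lipschitz at the cost of
    one level, and the symbol [d] of the nonlinearity costs another one. *)
Lemma ifB_lip p s s' f g :
  wn p (fun k => B s f g k - B s' f g k) <= 3 * `|s - s'| * (wn p.+2 f * wn p.+2 g).
Proof.
set f1 := phase s f; set f2 := phase s' f; set g1 := phase s g; set g2 := phase s' g.
pose T0 k := d k * tconv F f1 g1 k.
pose T1 k := phase (- s) T0 k - phase (- s') T0 k.
pose T2 k := d k * tconv F (fun j => f1 j - f2 j) g1 k.
pose T3 k := d k * tconv F (fun j => g1 j - g2 j) f2 k.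
have bdd p' h h' : wn p' (fun k => d k * tconv F h h' k) <= wn p'.+1 h * wn p'.+1 h'.
  apply: le_trans (wnorm_mult _ W_ge1 _ _ dW) _.
  exact: wnorm_tconv.
have lv h : wn p.+1 h <= wn p.+2 h by apply: wnorm_lvl.
have n0 q h : 0 <= wn q h by apply: wnorm_ge0.
have -> : wn p (fun k => B s f g k - B s' f g k) =
    wn p (fun k => T1 k + cis (- s' * ell k) * (T2 k + T3 k)).
  apply: eq_wnorm => // k _; rewrite /T1 /T2 /T3 /T0 /ifB /phase -/f1 -/f2 -/g1 -/g2.
  have -> : tconv F (fun j => f1 j - f2 j) g1 k = tconv F f1 g1 k - tconv F f2 g1 k.
    by rewrite tconvDl; congr (_ + _); rewrite -mulN1r -tconvZl; apply: eq_tconv => // j _; rewrite mulN1r.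
  have -> : tconv F (fun j => g1 j - g2 j) f2 k = tconv F f2 g1 k - tconv F f2 g2 k.
    rewrite tconvDl [in RHS]tconvC; congr (_ + _).
    by rewrite -mulN1r [in RHS]tconvC -tconvZl; apply: eq_tconv => // j _; rewrite mulN1r.
  by ring.
apply: le_trans (wnormD _ W_ge1 _ _ _) _; rewrite wnorm_cis.
have h1 : wn p T1 <= `|s - s'| * (wn p.+2 f * wn p.+2 g).
  apply: le_trans (wnorm_phase_lip _ _ _ _) _.
  have -> : - s - - s' = - (s - s') by ring.
  rewrite normrN ler_wpM2l //; apply: le_trans (bdd _ _ _) _.
  by rewrite !wnorm_phase.
have h2 : wn p T2 <= `|s - s'| * (wn p.+2 f * wn p.+2 g).
  apply: le_trans (bdd _ _ _) _.
  apply: le_trans (ler_wpM2r (n0 _ _) (wnorm_phase_lip _ _ _ _)) _.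
  by rewrite wnorm_phase -mulrA ler_wpM2l // ler_wpM2l.
have h3 : wn p T3 <= `|s - s'| * (wn p.+2 f * wn p.+2 g).
  apply: le_trans (bdd _ _ _) _.
  apply: le_trans (ler_wpM2r (n0 _ _) (wnorm_phase_lip _ _ _ _)) _.
  by rewrite wnorm_phase -mulrA ler_wpM2l // mulrC ler_wpM2r.
have := wnormD F W_ge1 p T2 T3; lra.
Qed.

Lemma ifBC s f g k : B s f g k = B s g f k.
Proof. by rewrite /ifB tconvC. Qed.

Lemma ifBDr s f g g' k : B s f (fun j => g j + g' j) k = B s f g k + B s f g' k.
Proof.
rewrite /ifB [in LHS]tconvC; have -> : tconv F (phase s (fun j => g j + g' j)) (phase s f) k =
   tconv F (phase s f) (phase s g) k + tconv F (phase s f) (phase s g') k.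
  rewrite [in X in _ = X + _]tconvC [in X in _ = _ + X]tconvC -tconvDl.
  by apply: eq_tconv => // j _; rewrite /phase mulrDr.
by ring.
Qed.

Lemma ifBZr s f (c : R[i]) g k : B s f (fun j => c * g j) k = c * B s f g k.
Proof.
rewrite /ifB [in LHS]tconvC [in RHS]tconvC.
have -> : tconv F (phase s (fun j => c * g j)) (phase s f) k =
   c * tconv F (phase s g) (phase s f) k.
  by rewrite -tconvZl; apply: eq_tconv => // j _; rewrite /phase mulrCA.
by ring.
Qed.

Lemma eq_ifB s f f' g g' k : (forall j, j \in F -> f j = f' j) ->
  (forall j, j \in F -> g j = g' j) -> B s f g k = B s f' g' k.
Proof.
by move=> ef eg; rewrite /ifB; do 2 congr (_ * _); apply: eq_tconv => j jF; rewrite /phase ?ef ?eg.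
Qed.

End Estimates.
End Bilinear.

Section Orders.
Variables (R : realType) (I : zmodType) (W : I -> R) (ell : I -> R) (d : I -> R[i]).
Hypothesis W_ge1 : forall k, 1 <= W k.
Hypothesis WD : forall j l, W (j + l) <= W j * W l.
Hypothesis ellW : forall k, `|ell k| <= W k.
Hypothesis dW : forall k, cn (d k) <= W k.

Local Notation E := (I -> R[i]).

Variables (P : Type) (F : P -> seq I) (h : P -> R).
Hypothesis F_uniq : forall x, uniq (F x).
Hypothesis h01 : forall x, 0 <= h x <= 1.

Local Notation wn x := (wnorm (F x) W).
Local Notation B := (ifB ell d).

(** [f x] is of order [h x ^+ n] at level [p], with a constant that is uniform
    over all instances [x], in particular over all truncations [F x]. *)
Definition bigO p n (f : P -> E) : Prop :=
  exists2 C, 0 <= C & forall x, wn x p (f x) <= C * h x ^+ n.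

Lemma h_ge0 x : 0 <= h x. Proof. by case/andP: (h01 x). Qed.
Lemma h_le1 x : h x <= 1. Proof. by case/andP: (h01 x). Qed.

Lemma eq_bigO p n (f g : P -> E) : (forall x k, k \in F x -> f x k = g x k) ->
  bigO p n f -> bigO p n g.
Proof.
by move=> e [C C0 H]; exists C => // x; rewrite -(eq_wnorm W_ge1 _ (e x)).
Qed.

Lemma bigO_weaken p p' n n' (f : P -> E) : (p' <= p)%N -> (n' <= n)%N ->
  bigO p n f -> bigO p' n' f.
Proof.
move=> pp nn [C C0 H]; exists C => // x; apply: le_trans (wnorm_lvl _ W_ge1 _ pp) _.
apply: le_trans (H x) _; rewrite ler_wpM2l //.
by rewrite ler_wiXn2l // ?h_ge0 ?h_le1.
Qed.

Lemma bigOD p n (f g : P -> E) : bigO p n f -> bigO p n g ->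
  bigO p n (fun x k => f x k + g x k).
Proof.
move=> [C C0 H] [D D0 G]; exists (C + D); first exact: addr_ge0.
by move=> x; apply: le_trans (wnormD _ W_ge1 _ _ _) _; rewrite mulrDl lerD.
Qed.

Lemma bigOZ (c : R) p n (f : P -> E) : bigO p n f ->
  bigO p n (fun x k => c%:C * f x k).
Proof.
move=> [C C0 H]; exists (`|c| * C); first exact: mulr_ge0.
by move=> x; rewrite wnormZ -mulrA ler_wpM2l.
Qed.

Lemma bigO_h (c : R) m p n (f : P -> E) : bigO p n f ->
  bigO p (m + n) (fun x k => (c * h x ^+ m)%:C * f x k).
Proof.
move=> [C C0 H]; exists (`|c| * C); first exact: mulr_ge0.
move=> x; rewrite wnormZ normrM (ger0_norm (exprn_ge0 _ (h_ge0 x))) exprD.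
have -> : `|c| * C * (h x ^+ m * h x ^+ n) = `|c| * h x ^+ m * (C * h x ^+ n) by ring.
by rewrite ler_wpM2l // mulr_ge0 // exprn_ge0 // h_ge0.
Qed.

Lemma bigO_B p m n s (f g : P -> E) : bigO p.+1 m f -> bigO p.+1 n g ->
  bigO p (m + n) (fun x => B (F x) (s x) (f x) (g x)).
Proof.
move=> [C C0 H] [D D0 G]; exists (C * D); first exact: mulr_ge0.
move=> x; apply: le_trans (wnorm_ifB ell W_ge1 WD dW (F_uniq x) _ _ _ _) _.
by rewrite exprD mulrACA ler_pM ?wnorm_ge0.
Qed.

Lemma bigO_B_lip p m n c c' a (f g : P -> E) : bigO p.+2 m f -> bigO p.+2 n g ->
  bigO p (m + n).+1 (fun x k => B (F x) (a x + c * h x) (f x) (g x) k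
                              - B (F x) (a x + c' * h x) (f x) (g x) k).
Proof.
move=> [C C0 H] [D D0 G]; exists (3 * `|c - c'| * (C * D)).
  by rewrite !mulr_ge0.
move=> x; apply: le_trans (ifB_lip W_ge1 WD ellW dW (F_uniq x) _ _ _ _ _) _.
have -> : a x + c * h x - (a x + c' * h x) = (c - c') * h x by ring.
have -> : 3 * `|c - c'| * (C * D) * h x ^+ (m + n).+1 =
   3 * `|(c - c') * h x| * ((C * h x ^+ m) * (D * h x ^+ n)).
  by rewrite normrM (ger0_norm (h_ge0 x)) exprS exprD; ring.
by rewrite ler_wpM2l ?mulr_ge0 // ler_pM ?wnorm_ge0.
Qed.

Section LocalError.
Variables (a : P -> R) (Y : P -> nat -> R -> E) (K : R).
Hypothesis K0 : 0 <= K.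
Hypothesis YD : forall x i, (i < 5)%N -> edot (F x) (a x) (a x + h x) (Y x i) (Y x i.+1).
Hypothesis YK : forall x i t, (i <= 5)%N -> a x <= t <= a x + h x ->
  wn x (5 - i) (Y x i t) <= K.
Hypothesis Y1 : forall x t k, a x <= t <= a x + h x ->
  Y x 1 t k = B (F x) t (Y x 0 t) (Y x 0 t) k.

Lemma in_step x c : 0 <= c <= 1 -> a x <= a x + c * h x <= a x + h x.
Proof.
move=> /andP[c0 c1]; rewrite lerDl mulr_ge0 ?h_ge0 //= lerD2l.
by rewrite -[X in _ <= X]mul1r ler_wpM2r ?h_ge0.
Qed.

Lemma bigO_Y c i : 0 <= c <= 1 -> (i <= 5)%N ->
  bigO (5 - i) 0 (fun x => Y x i (a x + c * h x)).
Proof.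
by move=> c01 i5; exists K => // x; rewrite expr0 mulr1 YK // in_step.
Qed.

Lemma bigO_taylor c i m : 0 <= c <= 1 -> (i + m <= 5)%N ->
  bigO (5 - (i + m)) m (fun x k => Y x i (a x + c * h x) k -
    \sum_(n < m) ((c * h x) ^+ n / n`!%:R)%:C * Y x (i + n)%N (a x) k).
Proof.
move=> c01 im; exists K => // x.
have /andP[t1 t2] := in_step x c01.
have D n : (n < m)%N -> edot (F x) (a x) (a x + h x) (Y x (i + n)%N) (Y x (i + n.+1)%N).
  by move=> nm; rewrite addnS; apply: YD; lia.
have Kb t : a x <= t <= a x + h x -> wn x (5 - (i + m)) (Y x (i + m)%N t) <= K.
  by move=> tb; apply: YK.
have := wnorm_taylor W_ge1 (Y := fun n => Y x (i + n)%N) t1 t2 K0 D Kb.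
rewrite /= addn0; have -> : a x + c * h x - a x = c * h x by ring.
move/le_trans; apply; rewrite ler_wpM2l // exprMn -[X in _ <= X]mul1r.
rewrite ler_wpM2r ?exprn_ge0 ?h_ge0 // exprn_ile1 //; by case/andP: c01.
Qed.

Local Notation v i := (fun x => Y x i (a x)).
Local Notation yh i := (fun x => Y x i (a x + 2^-1 * h x)).
Local Notation y1 i := (fun x => Y x i (a x + 1 * h x)).

Let half01 : 0 <= (2^-1 : R) <= 1.
Proof. by apply/andP; split; lra. Qed.
Let one01 : 0 <= (1 : R) <= 1.
Proof. by rewrite lexx ler01. Qed.

Lemma bigO_v i : (i <= 5)%N -> bigO (5 - i) 0 (v i).
Proof.
move=> i5; have /(bigO_Y (c := 0)) : 0 <= (0 : R) <= 1 by rewrite lexx ler01.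
move=> /(_ _ i5); apply: eq_bigO => x k _; by rewrite mul0r addr0.
Qed.


Local Notation sh x := (a x + 2^-1 * h x).
Local Notation s1 x := (a x + 1 * h x).

(* The differences between the arguments of the stages and the exact solution
   at the stage times, and the resulting differences of the slopes. *)
Let e2 x : E := fun k => v 0 x k + (2^-1 * h x)%:C * v 1 x k - yh 0 x k.
Let d2 x : E := fun k => 2 * B (F x) (sh x) (yh 0 x) (e2 x) k + B (F x) (sh x) (e2 x) (e2 x) k.
Let e3 x : E := fun k =>
  v 0 x k + (2^-1 * h x)%:C * (yh 1 x k + d2 x k) - yh 0 x k.
Let d3 x : E := fun k => 2 * B (F x) (sh x) (yh 0 x) (e3 x) k + B (F x) (sh x) (e3 x) (e3 x) k.
Let e4 x : E := fun k => v 0 x k + (h x)%:C * (yh 1 x k + d3 x k) - y1 0 x k.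
Let d4 x : E := fun k => 2 * B (F x) (s1 x) (y1 0 x) (e4 x) k + B (F x) (s1 x) (e4 x) (e4 x) k.

Let O_e2 : bigO 3 2 e2.
Proof.
have /(bigOZ (-1)) := bigO_taylor (i := 0) (m := 2) half01 isT.
apply: eq_bigO => x k _; rewrite /e2.
by rewrite !big_ord_recr big_ord0 /= !add0n !fact0 !factS fact0; field.
Qed.

Let O_e2_3 : bigO 2 3 (fun x k => e2 x k + (8^-1 * h x ^+ 2)%:C * v 2 x k).
Proof.
have /(bigOZ (-1)) := bigO_taylor (i := 0) (m := 3) half01 isT.
apply: eq_bigO => x k _; rewrite /e2.
by rewrite !big_ord_recr big_ord0 /= !add0n !fact0 !factS fact0; field.
Qed.

Let O_e2_4 : bigO 1 4 (fun x k => e2 x k + (8^-1 * h x ^+ 2)%:C * v 2 x k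
                        + (48^-1 * h x ^+ 3)%:C * v 3 x k).
Proof.
have /(bigOZ (-1)) := bigO_taylor (i := 0) (m := 4) half01 isT.
apply: eq_bigO => x k _; rewrite /e2.
by rewrite !big_ord_recr big_ord0 /= !add0n !fact0 !factS fact0; field.
Qed.

Let O_f1 : bigO 3 1 (fun x k => yh 1 x k - v 1 x k).
Proof.
have := bigO_taylor (i := 1) (m := 1) half01 isT.
apply: eq_bigO => x k _.
by rewrite !big_ord_recr big_ord0 /= !fact0; field.
Qed.

Let O_f2 : bigO 2 2 (fun x k => yh 1 x k - v 1 x k - (2^-1 * h x)%:C * v 2 x k).
Proof.
have := bigO_taylor (i := 1) (m := 2) half01 isT.
apply: eq_bigO => x k _.
by rewrite !big_ord_recr big_ord0 /= !factS !fact0; field.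
Qed.

Let O_f3 : bigO 1 3 (fun x k => yh 1 x k - v 1 x k - (2^-1 * h x)%:C * v 2 x k
                      - (8^-1 * h x ^+ 2)%:C * v 3 x k).
Proof.
have := bigO_taylor (i := 1) (m := 3) half01 isT.
apply: eq_bigO => x k _.
by rewrite !big_ord_recr big_ord0 /= !factS !fact0; field.
Qed.

(** The defect of Simpson's rule applied to [y' = Y 1]. *)
Let O_simpson : bigO 0 5 (fun x k => y1 0 x k - v 0 x k -
  (6^-1 * h x)%:C * (v 1 x k + 4 * yh 1 x k + y1 1 x k)).
Proof.
have T := bigO_taylor (i := 0) (m := 5) one01 isT.
have /(bigO_h (- 6^-1 * 4) 1) Th := bigO_taylor (i := 1) (m := 4) half01 isT.
have /(bigO_h (- 6^-1) 1) T1 := bigO_taylor (i := 1) (m := 4) one01 isT.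
move: (bigOD T (bigOD Th T1)); apply: eq_bigO => x k _.
by rewrite !big_ord_recr !big_ord0 /= !factS !fact0; field.
Qed.

(** A slope evaluated at an argument that is off by [e] is off by the linear
    term and a square, and each of them costs one level. *)
Let O_d (e : P -> E) c i p n : 0 <= c <= 1 -> (p < 5)%N -> bigO p.+1 n e ->
  i = 0%N ->
  bigO p n (fun x k => 2 * B (F x) (a x + c * h x) (Y x i (a x + c * h x)) (e x) k
                       + B (F x) (a x + c * h x) (e x) (e x) k).
Proof.
move=> c01 p5 He ->.
have Oy : bigO p.+1 0 (fun x => Y x 0%N (a x + c * h x)).
  by apply: bigO_weaken (bigO_Y c01 (leq0n _)).
have H1 := bigOZ 2 (bigO_B (fun x => a x + c * h x) Oy He).
have H2 : bigO p n (fun x => B (F x) (a x + c * h x) (e x) (e x)).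
  by apply: bigO_weaken (bigO_B (fun x => a x + c * h x) He He); rewrite // leq_addr.
move: (bigOD H1 H2); apply: eq_bigO => x k _.
by congr (_ * _ + _); rewrite rmorph_nat.
Qed.

Let O_d2 : bigO 2 2 d2.
Proof. by apply: (O_d (i := 0)) => //; exact: O_e2. Qed.

Let O_e3 : bigO 2 2 e3.
Proof.
have H1 : bigO 2 2 e2 by apply: bigO_weaken O_e2.
have H2 : bigO 2 2 (fun x k => (2^-1 * h x ^+ 1)%:C * (yh 1 x k - v 1 x k)).
  by apply: bigO_weaken (bigO_h (2^-1) 1 O_f1).
have H3 : bigO 2 2 (fun x k => (2^-1 * h x ^+ 1)%:C * d2 x k).
  by apply: bigO_weaken (bigO_h (2^-1) 1 O_d2).
move: (bigOD H1 (bigOD H2 H3)); apply: eq_bigO => x k _.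
by rewrite /e3 /e2; field.
Qed.

Let O_d3 : bigO 1 2 d3.
Proof. by apply: (O_d (i := 0)) => //; exact: O_e3. Qed.

(** The errors of the two midpoint stages cancel to leading order. *)
Let O_e23 : bigO 2 3 (fun x k => e2 x k + e3 x k).
Proof.
have H1 := bigOZ 2 O_e2_3.
have H2 := bigO_h (2^-1) 1 O_f2.
have H3 := bigO_h (2^-1) 1 O_d2.
move: (bigOD H1 (bigOD H2 H3)); apply: eq_bigO => x k _.
by rewrite /e3 /e2; field.
Qed.

Let BD s x (f g g' : E) k :
  B (F x) s f (fun j => g j + g' j) k = B (F x) s f g k + B (F x) s f g' k.
Proof. exact: ifBDr. Qed.

Let O_d23 : bigO 1 3 (fun x k => d2 x k + d3 x k).
Proof.
have Oy : bigO 2 0 (fun x => yh 0 x).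
  by apply: bigO_weaken (bigO_Y half01 (leq0n _)).
have H1 := bigOZ 2 (bigO_B (fun x => sh x) Oy O_e23).
have O2 : bigO 2 2 e2 by apply: bigO_weaken O_e2.
have H2 : bigO 1 3 (fun x => B (F x) (sh x) (e2 x) (e2 x)).
  by apply: bigO_weaken (bigO_B (fun x => sh x) O2 O2).
have H3 : bigO 1 3 (fun x => B (F x) (sh x) (e3 x) (e3 x)).
  by apply: bigO_weaken (bigO_B (fun x => sh x) O_e3 O_e3).
move: (bigOD H1 (bigOD H2 H3)); apply: eq_bigO => x k _.
by rewrite /d2 /d3 BD; ring.
Qed.

Let O_e4_4 : bigO 1 4 (fun x k => e4 x k + (24^-1 * h x ^+ 3)%:C * v 3 x k
                        - (h x)%:C * d3 x k).
Proof.
have /(bigOZ (-1)) T := bigO_taylor (i := 0) (m := 4) one01 isT.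
have T1 := bigO_h 1 1 O_f3.
move: (bigOD T T1); apply: eq_bigO => x k _.
by rewrite /e4 !big_ord_recr !big_ord0 /= !factS !fact0; field.
Qed.

Let O_e4 : bigO 1 3 e4.
Proof.
have H1 : bigO 1 3 (fun x k => e4 x k + (24^-1 * h x ^+ 3)%:C * v 3 x k
                        - (h x)%:C * d3 x k) by apply: bigO_weaken O_e4_4.
have H2 : bigO 1 3 (fun x k => (- 24^-1 * h x ^+ 3)%:C * v 3 x k).
  by apply: bigO_weaken (bigO_h (- 24^-1) 3 (bigO_v (i := 3) isT)).
have H3 := bigO_h 1 1 O_d3.
move: (bigOD H1 (bigOD H2 H3)); apply: eq_bigO => x k _.
by field.
Qed.

(** Moving the linearized slope from the midpoint to the end point gains one
    order and costs two levels. *)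
Let O_shift n (g : P -> E) : bigO 2 n g ->
  bigO 0 n.+1 (fun x k => B (F x) (sh x) (yh 0 x) (g x) k - B (F x) (s1 x) (y1 0 x) (g x) k).
Proof.
move=> Og.
have Oy : bigO 2 0 (fun x => yh 0 x).
  by apply: bigO_weaken (bigO_Y half01 (leq0n _)).
have H1 := bigO_B_lip (2^-1) 1 a Oy Og.
have Hy : bigO 1 1 (fun x k => yh 0 x k - y1 0 x k).
  have Th := bigO_taylor (i := 0) (m := 1) half01 isT.
  have /(bigOZ (-1)) T1 := bigO_taylor (i := 0) (m := 1) one01 isT.
  have : bigO 1 1 _ := bigO_weaken _ _ (bigOD Th T1).
  move=> /(_ isT isT); apply: eq_bigO => x k _.
  by rewrite !big_ord_recr !big_ord0 /= !fact0; field.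
have Og' : bigO 1 n g by apply: bigO_weaken Og.
have H2 := bigO_B (fun x => s1 x) Og' Hy.
have H2' : bigO 0 (0 + n).+1 (fun x => B (F x) (s1 x) (g x) (fun k => yh 0 x k - y1 0 x k)).
  by rewrite add0n -addn1.
move: (bigOD H1 H2'); rewrite add0n; apply: eq_bigO => x k _.
have -> : B (F x) (s1 x) (g x) (fun k => yh 0 x k - y1 0 x k) k =
   B (F x) (s1 x) (g x) (yh 0 x) k - B (F x) (s1 x) (g x) (y1 0 x) k.
  rewrite ifBDr; congr (_ + _); rewrite -mulN1r -ifBZr.
  by apply: eq_ifB => // j _; rewrite mulN1r.
by rewrite [B _ _ (g x) (yh 0 x) k]ifBC [B _ _ (g x) (y1 0 x) k]ifBC; ring.
Qed.

(** The weighted slope errors [2 d2 + 2 d3 + d4] vanish to third order. The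
    leading parts of [2 (e2 + e3)] and of [e4] are [w] and [- w], so that they
    cancel up to the shift from the midpoint to the end point; the parts
    [h d2] and [h d3] that the stages inherit from one another cancel because
    [d2 + d3] is of order three. *)
Let O_stages : bigO 0 4 (fun x k => 2 * d2 x k + 2 * d3 x k + d4 x k).
Proof.
have Oyh : bigO 1 0 (fun x => yh 0 x).
  by apply: bigO_weaken (bigO_Y half01 (leq0n _)).
have Oy1 : bigO 1 0 (fun x => y1 0 x).
  by apply: bigO_weaken (bigO_Y one01 (leq0n _)).
pose w x : E := fun k => (24^-1 * h x ^+ 3)%:C * v 3 x k.
have Ow : bigO 2 3 w := bigO_h (24^-1) 3 (bigO_v (i := 3) isT).
pose r1 x : E := fun k => 2 * (e2 x k + e3 x k) - w x k - (h x)%:C * d2 x k.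
have Or1 : bigO 1 4 r1.
  move: (bigOD (bigOZ 4 O_e2_4) (bigO_h 1 1 O_f3)); apply: eq_bigO => x k _.
  by rewrite /r1 /w /e3 /e2; field.
pose r2 x : E := fun k => e4 x k + w x k - (h x)%:C * d3 x k.
have Or2 : bigO 1 4 r2 := O_e4_4.
have H1 := bigOZ 2 (O_shift Ow).
have H2 := bigO_h 2 1 (O_shift O_d2).
have H3 := bigO_h 2 1 (bigO_B (fun x => s1 x) Oy1 O_d23).
have H4 := bigOZ 2 (bigO_B (fun x => sh x) Oyh Or1).
have H5 := bigOZ 2 (bigO_B (fun x => s1 x) Oy1 Or2).
have H6 : bigO 0 4 (fun x => B (F x) (sh x) (e2 x) (e2 x)).
  by apply: bigO_weaken (bigO_B (fun x => sh x) O_e2 O_e2).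
have H7 : bigO 0 4 (fun x => B (F x) (sh x) (e3 x) (e3 x)).
  by apply: bigO_weaken (bigO_B (fun x => sh x) O_e3 O_e3).
have H8 : bigO 0 4 (fun x => B (F x) (s1 x) (e4 x) (e4 x)).
  by apply: bigO_weaken (bigO_B (fun x => s1 x) O_e4 O_e4).
move: (bigOD (bigOD (bigOD H1 H2) (bigOD H3 H4)) (bigOD H5
  (bigOD (bigOD (bigOZ 2 H6) (bigOZ 2 H7)) H8))).
apply: eq_bigO => x k _.
have E23 : 2 * (B (F x) (sh x) (yh 0 x) (e2 x) k + B (F x) (sh x) (yh 0 x) (e3 x) k) =
    B (F x) (sh x) (yh 0 x) (w x) k + (h x)%:C * B (F x) (sh x) (yh 0 x) (d2 x) k
    + B (F x) (sh x) (yh 0 x) (r1 x) k.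
  rewrite -BD -ifBZr -ifBZr -!BD; apply: eq_ifB => // j _.
  by rewrite /r1; ring.
have E4 : B (F x) (s1 x) (y1 0 x) (e4 x) k = - B (F x) (s1 x) (y1 0 x) (w x) k
   + (h x)%:C * B (F x) (s1 x) (y1 0 x) (d3 x) k + B (F x) (s1 x) (y1 0 x) (r2 x) k.
  rewrite -mulN1r -!ifBZr -!BD; apply: eq_ifB => // j _.
  by rewrite /r2; ring.
have -> : 2 * d2 x k + 2 * d3 x k + d4 x k =
  2 * (2 * (B (F x) (sh x) (yh 0 x) (e2 x) k + B (F x) (sh x) (yh 0 x) (e3 x) k))
  + 2 * B (F x) (s1 x) (y1 0 x) (e4 x) k
  + 2 * B (F x) (sh x) (e2 x) (e2 x) k + 2 * B (F x) (sh x) (e3 x) (e3 x) k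
  + B (F x) (s1 x) (e4 x) (e4 x) k by rewrite /d2 /d3 /d4; ring.
by rewrite E23 E4 BD; ring.
Qed.

(** The scheme is Simpson's rule plus one sixth of [h] times the weighted slope
    errors. *)
Lemma ifrk4_local_error : bigO 0 5 (fun x k =>
  Y x 0%N (a x + h x) k - ifrk4_coef ell d (F x) (h x) (a x) (Y x 0%N (a x)) k).
Proof.
move: (bigOD O_simpson (bigO_h (- 6^-1) 1 O_stages)); apply: eq_bigO => x k _.
have ax : a x <= a x <= a x + h x by rewrite lexx lerDl h_ge0.
have V1 := Y1 _ ax.
have sq s (y e : E) j : B (F x) s (fun i => y i + e i) (fun i => y i + e i) j =
    B (F x) s y y j + (2 * B (F x) s y e j + B (F x) s e e j).
  have BDl g : B (F x) s (fun i => y i + e i) g j = B (F x) s y g j + B (F x) s e g j.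
    by rewrite ifBC BD ifBC [in X in _ + X]ifBC.
  by rewrite BD !BDl [B _ _ e y j]ifBC; ring.
have hE : a x + h x / 2 = sh x by rewrite mulrC.
have h1E : a x + h x = s1 x by rewrite mul1r.
rewrite /ifrk4_coef hE h1E.
have K2 j : B (F x) (sh x)
   (fun i => v 0 x i + (h x)%:C * B (F x) (a x) (v 0 x) (v 0 x) i / 2)
   (fun i => v 0 x i + (h x)%:C * B (F x) (a x) (v 0 x) (v 0 x) i / 2) j =
   yh 1 x j + d2 x j.
  rewrite (Y1 _ (in_step x half01)) /d2 -sq.
  by apply: eq_ifB => i _; rewrite -V1 /e2; field.
have K3 j : B (F x) (sh x)
   (fun i => v 0 x i + (h x)%:C * (yh 1 x i + d2 x i) / 2)
   (fun i => v 0 x i + (h x)%:C * (yh 1 x i + d2 x i) / 2) j =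
   yh 1 x j + d3 x j.
  rewrite {3}[yh 1 x](funext (fun j => Y1 j (in_step x half01))) /d3 -sq.
  by apply: eq_ifB => i _; rewrite /e3; field.
have K4 j : B (F x) (s1 x)
   (fun i => v 0 x i + (h x)%:C * (yh 1 x i + d3 x i))
   (fun i => v 0 x i + (h x)%:C * (yh 1 x i + d3 x i)) j =
   y1 1 x j + d4 x j.
  rewrite (Y1 _ (in_step x one01)) /d4 -sq.
  by apply: eq_ifB => i _; rewrite /e4; field.
rewrite (funext K2) (funext K3) (funext K4) -V1.
by field.
Qed.

End LocalError.
End Orders.

(** * Error propagation for the truncated system *)

Section TruncatedSystem.
Variables (R : realType) (I : zmodType) (W : I -> R) (ell c : I -> R).
Hypothesis W_ge1 : forall k, 1 <= W k.
Hypothesis WD : forall j l, W (j + l) <= W j * W l.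
Hypothesis ellW : forall k, `|ell k| <= W k.
Hypothesis cW : forall k, `|c k| <= W k.
Hypothesis cD : forall j l, c (j + l) = c j + c l.

Local Notation E := (I -> R[i]).
Local Notation d := (fun k => 'i * (c k)%:C).

Let dW k : cn (d k) <= W k. Proof. exact: cn_imul. Qed.

Definition tsol (F : seq I) (a b : R) (y : R -> E) : Prop :=
  edot F a b y (fun t k => 'i * (ell k)%:C * y t k + d k * tconv F (y t) (y t) k).

(** The equation trades one time derivative for one level of smoothness, so
    a bound at level [m + n] controls [m] time derivatives. *)
Lemma tsol_creg (K : R) m n : 0 <= K -> exists2 K', 0 <= K' &
  forall F a b y, uniq F -> tsol F a b y -> creg F W a b 0 (m + n) K y ->
  creg F W a b m n K' y.
Proof.
move=> K0; elim: m n => [|m IH] n; first by exists K.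
have [K' K'0 H] := IH n.+1.
have K''0 : 0 <= K' + 2 ^+ m * (K' * K') by rewrite addr_ge0 ?mulr_ge0 ?exprn_ge0.
exists (K + (K' + 2 ^+ m * (K' * K'))); first exact: addr_ge0.
move=> F a b y uF Hy ry.
have {}H : creg F W a b m n.+1 K' y by apply: H => //; rewrite addnS -addSn.
split; first by move=> t tab; apply: le_trans (creg_bound ry tab) _; rewrite lerDl.
exists (fun t k => 'i * (ell k)%:C * y t k + d k * tconv F (y t) (y t) k) => //.
apply: creg_weaken (_ : K' + 2 ^+ m * (K' * K') <= _) _; first by rewrite lerDr.
apply: cregD => //.
  by apply: creg_mult => // k; exact: cn_imul.
by apply: creg_mult => //; exact: creg_tconv.
Qed.

Lemma phaseK (s : R) (f : E) : phase ell s (phase ell (- s) f) = f.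
Proof.
apply/funext => k; rewrite /phase mulrA -cisD.
have -> : s * ell k + - s * ell k = 0 by ring.
by rewrite cis0 mul1r.
Qed.

(** The instances over which the constant of the local error has to be uniform:
    truncation, time, step and solution. *)
Record step_data (K : R) : Type := StepData {
  sd_F : seq I; sd_a : R; sd_h : R; sd_Y : nat -> R -> E;
  sd_uniq : uniq sd_F;
  sd_h01 : 0 <= sd_h <= 1;
  sd_D : forall i, (i < 5)%N -> edot sd_F sd_a (sd_a + sd_h) (sd_Y i) (sd_Y i.+1);
  sd_K : forall i t, (i <= 5)%N -> sd_a <= t <= sd_a + sd_h ->
    wnorm sd_F W (5 - i) (sd_Y i t) <= K;
  sd_1 : forall t k, sd_a <= t <= sd_a + sd_h ->
    sd_Y 1 t k = ifB ell d sd_F t (sd_Y 0%N t) (sd_Y 0%N t) k }.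

(** In the variable [phase (- t) (y t)] the equation has bounded derivatives up
    to order five, so that the scheme is consistent of order four. *)
Lemma tsol_local_error (K : R) : 0 <= K -> exists2 C, 0 <= C &
  forall F (a h : R) y, uniq F -> 0 <= h <= 1 -> tsol F a (a + h) y ->
  (forall t, a <= t <= a + h -> wnorm F W 5 (y t) <= K) ->
  wnorm F W 0 (fun k => phase ell (- (a + h)) (y (a + h)) k
     - ifrk4_coef ell d F h a (phase ell (- a) (y a)) k) <= C * h ^+ 5.
Proof.
move=> K0; have [K4 K40 H4] := tsol_creg 4 1 K0.
pose K' := K + 2 ^+ 4 * (2 ^+ 4 * (K4 * K4)).
have K'1 : 2 ^+ 4 * (2 ^+ 4 * (K4 * K4)) <= K' by rewrite lerDr.
have K'0 : 0 <= K' by rewrite addr_ge0 ?mulr_ge0.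
have [C C0 HC] := @ifrk4_local_error R I W ell d W_ge1 WD ellW dW (step_data K')
  (@sd_F K') (@sd_h K') (@sd_uniq K') (@sd_h01 K') (@sd_a K') (@sd_Y K') K' K'0
  (@sd_D K') (@sd_K K') (@sd_1 K').
exists C => // F a h y uF h01 Hy Hb.
have ry : creg F W a (a + h) 4 1 K4 y by apply: H4 => //; split.
pose G t : E := fun k => cis (- t * ell k) * (d k * tconv F (y t) (y t) k).
have cE t k : cis (t * - ell k) = cis (- t * ell k) :> R[i] by rewrite mulrN mulNr.
have NW k : `|- ell k| <= W k by rewrite normrN.
have rG : creg F W a (a + h) 4 0 K' G.
  have r1 : creg F W a (a + h) 4 0 (2 ^+ 4 * (K4 * K4)) (fun t k => d k * tconv F (y t) (y t) k).
    apply: (creg_mult (d := d) W_ge1 dW); exact: (creg_tconv uF W_ge1 WD K40 K40 ry ry).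
  have r1K : 0 <= 2 ^+ 4 * (K4 * K4) by rewrite !mulr_ge0 ?exprn_ge0.
  have := creg_cis W_ge1 NW r1K r1.
  move=> /(creg_weaken K'1); suff -> : G = fun t k => cis (t * - ell k) *
     (d k * tconv F (y t) (y t) k) by [].
  by apply/funext => t; apply/funext => k; rewrite cE.
have DV : edot F a (a + h) (fun t => phase ell (- t) (y t)) G.
  move=> k kF; have := cderM (cder_cis a (a + h) (- ell k)) (Hy k kF).
  apply: cder_ext => t; first by rewrite cE.
  by move=> _; rewrite cE /G rmorphN /=; ring.
have [Y [Y0 Y1 YD YK]] := creg_derivatives DV rG.
have YD' i : (i < 5)%N -> edot F a (a + h) (Y i) (Y i.+1) by exact: YD.
have YK' i t : (i <= 5)%N -> a <= t <= a + h -> wnorm F W (5 - i) (Y i t) <= K'.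
  case: i => [_|i i5] tab; last by have := YK i t i5 tab; rewrite addn0 subSS.
  rewrite Y0 subn0 wnorm_phase; apply: le_trans (Hb t tab) _.
  by rewrite lerDl !mulr_ge0 ?exprn_ge0.
have Y1' t k : a <= t <= a + h -> Y 1%N t k = ifB ell d F t (Y 0%N t) (Y 0%N t) k.
  by move=> _; rewrite Y1 Y0 /ifB phaseK.
have := HC (StepData uF h01 YD' YK' Y1').
by rewrite /= Y0.
Qed.

Definition energy (F : seq I) (f : E) : R := \sum_(k <- F) cn (f k) ^+ 2.

Lemma energy_ge0 F f : 0 <= energy F f.
Proof. by apply: sumr_ge0 => k _; exact: sqr_ge0. Qed.

Lemma eq_energy F f g : (forall k, k \in F -> f k = g k) -> energy F f = energy F g.
Proof. by move=> H; rewrite /energy !big_seq; apply: eq_bigr => k /H ->. Qed.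

Lemma energy_le_wnorm F f : energy F f <= wnorm F W 0 f ^+ 2.
Proof.
have e : wnorm F W 0 f = \sum_(k <- F) cn (f k).
  by apply: eq_bigr => k _; rewrite expr0 mul1r.
rewrite expr2 [X in X * _]e mulr_suml /energy [leLHS]big_seq [leRHS]big_seq.
apply: ler_sum => k kF.
by rewrite expr2 ler_wpM2l ?cn_ge0 //; exact: cn_le_wnorm.
Qed.

Lemma energy_phase F s f : energy F (phase ell s f) = energy F f.
Proof. by apply: eq_bigr => k _; rewrite normcM cn_cis mul1r. Qed.

(** Young's inequality, weighted so that the first factor is absorbed by the
    growth rate of the flow over a step [h]. *)
Lemma energyD (h : R) F f g : 0 < h ->
  energy F (fun k => f k + g k) <= (1 + h) * energy F f + (1 + h^-1) * energy F g.
Proof.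
move=> h0; rewrite /energy !mulr_sumr -big_split /=; apply: ler_sum => k _.
have := le_normcD (f k) (g k).
set x := cn (f k); set y := cn (g k); set z := cn (f k + g k) => zxy.
have [x0 y0 z0] : [/\ 0 <= x, 0 <= y & 0 <= z] by split; exact: cn_ge0.
have h1 : z ^+ 2 <= (x + y) ^+ 2 by rewrite lerXn2r ?nnegrE ?addr_ge0.
apply: le_trans h1 _; rewrite -subr_ge0.
have -> : (1 + h) * x ^+ 2 + (1 + h^-1) * y ^+ 2 - (x + y) ^+ 2 = h^-1 * (h * x - y) ^+ 2.
  by field; rewrite gt_eqF.
by rewrite mulr_ge0 ?sqr_ge0 // invr_ge0 ltW.
Qed.

Section Stability.
Variables (F : seq I).
Hypothesis F_uniq : uniq F.
Hypothesis F_sym : forall k, k \in F -> - k \in F.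

Definition hermitian (f : E) := forall k, k \in F -> f (- k) = conjc (f k).

Lemma big_sym (T : nmodType) (f : I -> T) : \sum_(k <- F) f (- k) = \sum_(k <- F) f k.
Proof.
rewrite -(big_map (fun k => - k) xpredT f); apply: perm_big.
apply: uniq_perm => //; first by rewrite map_inj_uniq //; exact: oppr_inj.
move=> k; apply/mapP/idP => [[j jF ->]|kF]; first exact: F_sym.
by exists (- k); rewrite ?opprK //; exact: F_sym.
Qed.

(** The trilinear sum is [i] times a sum [S] with real symbol [c k], so its real
    part only sees [S - conjc S]. Exchanging the two factors [e] in [conjc S]
    turns [c k] into [c l], and [c k - c l = c j] is the symbol of the smooth
    factor [s]. *)
Lemma energy_transport (s e : E) : hermitian s ->
  cRe (\sum_(k <- F) conjc (e k) * (d k * tconv F s e k)) <=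
  2^-1 * wnorm F W 1 s * energy F e.
Proof.
move=> hs.
pose T k j l : R[i] := (j + l == k)%:R * (s j * e l * conjc (e k)).
pose S : R[i] := \sum_(k <- F) \sum_(j <- F) \sum_(l <- F) (c k)%:C * T k j l.
pose S' : R[i] := \sum_(k <- F) \sum_(j <- F) \sum_(l <- F) (c l)%:C * T k j l.
have eS : \sum_(k <- F) conjc (e k) * (d k * tconv F s e k) = 'i * S.
  rewrite mulr_sumr; apply: eq_bigr => k _.
  rewrite /tconv !mulr_sumr; apply: eq_bigr => j _.
  by rewrite !mulr_sumr; apply: eq_bigr => l _; rewrite /T; ring.
have cS : conjc S = S'.
  have -> : conjc S = \sum_(k <- F) \sum_(j <- F) \sum_(l <- F) (c k)%:C * conjc (T k j l).
    rewrite cJ_sum; apply: eq_bigr => k _.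
    rewrite cJ_sum; apply: eq_bigr => j _.
    rewrite cJ_sum; apply: eq_bigr => l _.
    by rewrite cJM cJ_real.
  rewrite /S' exchange_big [RHS]exchange_big /= -big_sym !big_seq.
  apply: eq_bigr => j jF; rewrite exchange_big /=.
  apply: eq_bigr => k _; apply: eq_bigr => l _; congr (_ * _).
  have -> : T k j l = (- j + k == l)%:R * (s j * e l * conjc (e k)).
    rewrite /T; congr (_%:R * _); congr (nat_of_bool _).
    by apply/eqP/eqP => <-; rewrite ?addKr ?addNKr.
  by rewrite /T !cJM cJK cJ_nat hs // cJK; ring.
have reS : cRe ('i * S) = 2^-1 * cRe ('i * (S - conjc S)).
  by rewrite !cReM !cImD cImN cImJ /=; lra.
rewrite eS reS.
have dS : S - conjc S = \sum_(k <- F) \sum_(j <- F) \sum_(l <- F) (c j)%:C * T k j l.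
  rewrite cS /S /S' -sumrB; apply: eq_bigr => k _.
  rewrite -sumrB; apply: eq_bigr => j _; rewrite -sumrB; apply: eq_bigr => l _.
  rewrite /T; case: eqP => [<-|_]; last by rewrite !mul0r !mulr0 subrr.
  by rewrite cD rmorphD /=; ring.
rewrite -mulrA ler_wpM2l ?invr_ge0 ?ler0n //.
apply: le_trans (ler_norm _) _; apply: le_trans (cRe_le _) _.
have -> : cn ('i * (S - conjc S)) = cn (S - conjc S).
  by rewrite normcM [cn 'i]/= expr0n add0r expr1n sqrtr1 mul1r.
rewrite dS.
pose Q k j l : R := (j + l == k)%:R * (W j ^+ 1 * cn (s j)) *
  (2^-1 * (cn (e l) ^+ 2 + cn (e k) ^+ 2)).
apply: (@le_trans _ _ (\sum_(k <- F) \sum_(j <- F) \sum_(l <- F) Q k j l)).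
  apply: le_trans (cn_sum _ _) _; apply: ler_sum => k _.
  apply: le_trans (cn_sum _ _) _; apply: ler_sum => j _.
  apply: le_trans (cn_sum _ _) _; apply: ler_sum => l _.
  rewrite /T /Q; case: eqP => _; last by rewrite !mul0r mulr0 normc0.
  rewrite !mul1r !normcM cnJ cn_real expr1 -!mulrA mulrA.
  have H1 : `|c j| * cn (s j) <= W j * cn (s j) by rewrite ler_wpM2r ?cn_ge0.
  have H2 : cn (e l) * cn (e k) <= 2^-1 * (cn (e l) ^+ 2 + cn (e k) ^+ 2).
    by have := sqr_ge0 (cn (e l) - cn (e k)); lra.
  by rewrite [leRHS]mulrA ler_pM ?mulr_ge0 ?cn_ge0.
rewrite exchange_big /wnorm mulr_suml /=; apply: ler_sum => j _.
pose D k l : R := (j + l == k)%:R.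
have -> : \sum_(k <- F) \sum_(l <- F) Q k j l = W j ^+ 1 * cn (s j) * (2^-1 *
   (\sum_(l <- F) cn (e l) ^+ 2 * \sum_(k <- F) D k l +
    \sum_(k <- F) cn (e k) ^+ 2 * \sum_(l <- F) D k l)).
  under [X in X + _]eq_bigr => l _ do rewrite mulr_sumr.
  under [X in _ + X]eq_bigr => l _ do rewrite mulr_sumr.
  rewrite [X in X + _]exchange_big /= -big_split /= !mulr_sumr.
  apply: eq_bigr => k _; rewrite -big_split /= !mulr_sumr.
  by apply: eq_bigr => l _; rewrite /Q /D; ring.
rewrite ler_wpM2l ?mulr_ge0 ?cn_ge0 ?WX_ge0 //.
have D1 l : \sum_(k <- F) D k l <= 1 by exact: sum_delta_le1.
have D2 k : \sum_(l <- F) D k l <= 1.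
  apply: le_trans (sum_delta_le1 R F_uniq (k - j)); apply: ler_sum => l _.
  rewrite /D; case: eqP => [<-|_]; last exact: ler0n.
  by rewrite addrC addKr eqxx.
have b1 : \sum_(l <- F) cn (e l) ^+ 2 * \sum_(k <- F) D k l <= energy F e.
  by apply: ler_sum => l _; rewrite -[leRHS]mulr1 ler_wpM2l ?sqr_ge0.
have b2 : \sum_(k <- F) cn (e k) ^+ 2 * \sum_(l <- F) D k l <= energy F e.
  by apply: ler_sum => l _; rewrite -[leRHS]mulr1 ler_wpM2l ?sqr_ge0.
lra.
Qed.

(** [L^2] stability of the flow, with a rate controlled by one derivative of
    the two solutions: the linear part is skew-adjoint and drops out. *)
Lemma tsol_stability (a b K : R) (y z : R -> E) : a <= b ->
  tsol F a b y -> tsol F a b z ->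
  (forall t, a <= t <= b -> hermitian (y t)) ->
  (forall t, a <= t <= b -> hermitian (z t)) ->
  (forall t, a <= t <= b -> wnorm F W 1 (y t) <= K) ->
  (forall t, a <= t <= b -> wnorm F W 1 (z t) <= K) ->
  energy F (fun k => y b k - z b k) <=
    expR (2 * K * (b - a)) * energy F (fun k => y a k - z a k).
Proof.
move=> ab Hy Hz hy hz by_ bz.
pose e t : E := fun k => y t k - z t k.
pose s t : E := fun k => y t k + z t k.
pose de t : E := fun k => 'i * (ell k)%:C * e t k + d k * tconv F (s t) (e t) k.
have De k : k \in F -> cder a b (fun t => e t k) (fun t => de t k).
  move=> kF; apply: cder_ext (cderD (Hy k kF) (cderZ (-1) (Hz k kF))) => t.
    by rewrite mulN1r.
  move=> _; rewrite /de; have -> : tconv F (s t) (e t) k =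
     tconv F (y t) (y t) k - tconv F (z t) (z t) k.
    have BDr f g g' : tconv F f (fun j => g j - g' j) k = tconv F f g k - tconv F f g' k.
      rewrite tconvC tconvDl tconvC; congr (_ + _); rewrite [in RHS]tconvC -mulN1r -tconvZl.
      by apply: eq_tconv => // j _; rewrite mulN1r.
    by rewrite /s /e tconvDl !BDr [tconv F (z t) (y t) k]tconvC; ring.
  by rewrite /e; ring.
have HE : rder a b (fun t => energy F (e t))
   (fun t => \sum_(k <- F) 2 * cRe (conjc (e t k) * de t k)).
  by apply: rder_sum => k kF; apply: rder_cn_sqr; exact: De.
apply: (rder_gronwall ab HE) => t /andP[at_ tb].
have tab : a <= t <= b by rewrite !ltW.
have hs : hermitian (s t).
  by move=> k kF; rewrite /s hy // hz // cJD.
have bs : wnorm F W 1 (s t) <= 2 * K.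
  by apply: le_trans (wnormD _ W_ge1 _ _ _) _; have := by_ t tab; have := bz t tab; lra.
have := energy_transport (e t) hs.
rewrite cRe_sum -mulr_sumr => H.
have -> : \sum_(k <- F) cRe (conjc (e t k) * de t k) =
   \sum_(k <- F) cRe (conjc (e t k) * (d k * tconv F (s t) (e t) k)).
  apply: eq_bigr => k _; rewrite /de mulrDr cReD -[RHS]add0r; congr (_ + _).
  have -> : conjc (e t k) * ('i * (ell k)%:C * e t k) = 'i * (ell k)%:C * (e t k * conjc (e t k)).
    by ring.
  by rewrite cn_mulJ -mulrA -rmorphM /= !(mul0r, mulr0, subr0).
apply: le_trans (ler_wpM2l (ler0n _ 2) H) _.
rewrite mulrA ler_wpM2r ?energy_ge0 //; lra.
Qed.

End Stability.
End TruncatedSystem.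

(** * Convergence for the truncated system *)

Lemma discrete_gronwall (R : realType) (lam h r : R) (e : nat -> R) (M : nat) :
  0 <= lam -> 0 <= h -> 0 <= r -> e 0%N <= 0 ->
  (forall n, (n < M)%N -> e n.+1 <= expR (lam * h) * e n + r) ->
  forall n, (n <= M)%N -> e n <= n%:R * r * expR (lam * (n%:R * h)).
Proof.
move=> lam0 h0 r0 e0 H; elim=> [_|n IH nM]; first by rewrite !mul0r.
apply: le_trans (H n nM) _.
have eE : lam * (n.+1%:R * h) = lam * h + lam * (n%:R * h) by rewrite -natr1; ring.
apply: (@le_trans _ _ (expR (lam * h) * (n%:R * r * expR (lam * (n%:R * h))) + r)).
  by rewrite lerD2r ler_pM2l ?expR_gt0 // IH // ltnW.
have -> : expR (lam * h) * (n%:R * r * expR (lam * (n%:R * h))) =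
    n%:R * r * expR (lam * (n.+1%:R * h)) by rewrite eE expRD; ring.
have : 1 <= expR (lam * (n.+1%:R * h)) by rewrite -expR0 ler_expR !mulr_ge0.
move: (expR _) => X X1; rewrite -natr1 !mulrDl mul1r lerD2l -[leLHS]mulr1.
exact: ler_wpM2l.
Qed.

Section Convergence.
Variables (R : realType) (I : zmodType) (W : I -> R) (ell c : I -> R).
Hypothesis W_ge1 : forall k, 1 <= W k.
Hypothesis WD : forall j l, W (j + l) <= W j * W l.
Hypothesis ellW : forall k, `|ell k| <= W k.
Hypothesis cW : forall k, `|c k| <= W k.
Hypothesis cD : forall j l, c (j + l) = c j + c l.

Local Notation E := (I -> R[i]).
Local Notation d := (fun k => 'i * (c k)%:C).

Lemma eq_ifrk4_coef F h s (V V' : E) : (forall k, k \in F -> V k = V' k) ->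
  forall k, k \in F -> ifrk4_coef ell d F h s V k = ifrk4_coef ell d F h s V' k.
Proof.
move=> e k kF; rewrite /ifrk4_coef.
have k1 j : ifB ell d F s V V j = ifB ell d F s V' V' j by exact: eq_ifB.
have k2 j : ifB ell d F (s + h / 2) (fun i => V i + h%:C * ifB ell d F s V V i / 2)
    (fun i => V i + h%:C * ifB ell d F s V V i / 2) j = _ :=
  eq_ifB _ _ _ _ (fun i iF => congr2 (fun x y => x + h%:C * y / 2) (e i iF) (k1 i))
   (fun i iF => congr2 (fun x y => x + h%:C * y / 2) (e i iF) (k1 i)).
have k3 j : _ = _ :=
  eq_ifB ell d (s + h / 2) j
   (fun i iF => congr2 (fun x y => x + h%:C * y / 2) (e i iF) (k2 i))
   (fun i iF => congr2 (fun x y => x + h%:C * y / 2) (e i iF) (k2 i)).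
have k4 j : _ = _ :=
  eq_ifB ell d (s + h) j
   (fun i iF => congr2 (fun x y => x + h%:C * y) (e i iF) (k3 i))
   (fun i iF => congr2 (fun x y => x + h%:C * y) (e i iF) (k3 i)).
by rewrite k1 k2 k3 k4 e.
Qed.

(** Lady Windermere's fan, for squared errors: the exact flow propagates the
    error of the previous step, and the local error enters with the weight
    [1 + h^-1] of Young's inequality. *)
Theorem ifrk4_coef_convergence (K T : R) : 0 <= K -> 0 < T -> exists2 C, 0 <= C &
  forall (F : seq I) (M : nat) (U : R -> E) (w : nat -> R -> E) (V : nat -> E),
  let h := T / M%:R in let t n := n%:R * h in
  uniq F -> (forall k, k \in F -> - k \in F) -> (0 < M)%N -> h <= 1 ->
  tsol ell c F 0 T U ->
  (forall s, 0 <= s <= T -> hermitian F (U s)) ->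
  (forall s, 0 <= s <= T -> wnorm F W 5 (U s) <= K) ->
  (forall n, (n < M)%N -> tsol ell c F (t n) (t n.+1) (w n)) ->
  (forall n s, (n < M)%N -> t n <= s <= t n.+1 -> hermitian F (w n s)) ->
  (forall n s, (n < M)%N -> t n <= s <= t n.+1 -> wnorm F W 5 (w n s) <= K) ->
  (forall n k, (n < M)%N -> k \in F -> w n (t n) k = phase ell (t n) (V n) k) ->
  (forall k, k \in F -> V 0%N k = U 0 k) ->
  (forall n k, (n < M)%N -> k \in F -> V n.+1 k = ifrk4_coef ell d F h (t n) (V n) k) ->
  forall n, (n <= M)%N ->
    energy F (fun k => U (t n) k - phase ell (t n) (V n) k) <= C * h ^+ 8.
Proof.
move=> K0 T0; have [C C0 HC] := tsol_local_error W_ge1 WD ellW cW K0.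
pose lam := 1 + 2 * K.
exists (T * (2 * C ^+ 2) * expR (lam * T)).
  by rewrite !mulr_ge0 ?expR_ge0 ?sqr_ge0 // ltW.
move=> F M U w V h t uF sF M0 h1 HU hU bU Hw hw bw w0 V0 VS.
have h0 : 0 < h by rewrite divr_gt0 // ltr0n.
have tS n : t n.+1 = t n + h by rewrite /t -natr1; ring.
have t0 n : 0 <= t n by rewrite mulr_ge0 // ltW.
have tM n : (n <= M)%N -> t n <= T.
  move=> nM; have -> : T = M%:R * h by rewrite mulrC divfK // pnatr_eq0 -lt0n.
  by rewrite ler_wpM2r ?ler_nat // ltW.
pose e n := energy F (fun k => U (t n) k - phase ell (t n) (V n) k).
have e0 : e 0%N <= 0.
  rewrite /e /energy big_seq big1 // => k kF.
  by rewrite /t mul0r /phase mul0r cis0 mul1r V0 // subrr normc0 expr0n.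
have lv f : wnorm F W 1 f <= wnorm F W 5 f by exact: wnorm_lvl.
have step n : (n < M)%N -> e n.+1 <= expR (lam * h) * e n + 2 * C ^+ 2 * h ^+ 9.
  move=> nM; have tn : t n <= t n.+1 by rewrite tS lerDl ltW.
  have inT s : t n <= s <= t n.+1 -> 0 <= s <= T.
    move=> /andP[s1 s2]; rewrite (le_trans (t0 n) s1) /=.
    exact: le_trans s2 (tM _ nM).
  pose f k := U (t n.+1) k - w n (t n.+1) k.
  pose g k := w n (t n.+1) k - phase ell (t n.+1) (V n.+1) k.
  have -> : e n.+1 = energy F (fun k => f k + g k).
    by apply: eq_energy => k _; rewrite /f /g; ring.
  apply: le_trans (energyD _ _ _ h0) _.
  have HUn : tsol ell c F (t n) (t n.+1) U.
    by move=> k kF; apply: cder_sub (HU k kF) => //; exact: tM.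
  have ef : energy F f <= expR (2 * K * h) * e n.
    have := tsol_stability W_ge1 cW cD uF sF (K := K) tn HUn (Hw n nM)
      (fun s st => hU s (inT s st)) (fun s st => hw n s nM st)
      (fun s st => le_trans (lv _) (bU s (inT s st)))
      (fun s st => le_trans (lv _) (bw n s nM st)).
    have -> : t n.+1 - t n = h by rewrite tS; ring.
    move=> /le_trans; apply; rewrite ler_wpM2l ?expR_ge0 //.
    rewrite le_eqVlt; apply/orP; left; apply/eqP.
    by apply: eq_energy => k kF; rewrite w0.
  have eg : energy F g <= C ^+ 2 * h ^+ 10.
    have -> : energy F g = energy F (fun k => phase ell (- t n.+1) (w n (t n.+1)) k
        - ifrk4_coef ell d F h (t n) (phase ell (- t n) (w n (t n))) k).
      rewrite -(energy_phase ell F (- t n.+1)); apply: eq_energy => k kF.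
      rewrite [LHS]/phase /g mulrBr; congr (_ - _).
      have -> : cis (- t n.+1 * ell k) * phase ell (t n.+1) (V n.+1) k =
          phase ell (- t n.+1) (phase ell (- - t n.+1) (V n.+1)) k by rewrite opprK.
      rewrite phaseK VS //; apply: eq_ifrk4_coef => // j jF.
      have -> : phase ell (- t n) (w n (t n)) j =
          phase ell (- t n) (phase ell (- - t n) (V n)) j.
        by rewrite opprK /phase w0.
      by rewrite phaseK.
    apply: le_trans (energy_le_wnorm W_ge1 _ _) _.
    have -> : C ^+ 2 * h ^+ 10 = (C * h ^+ 5) ^+ 2 by ring.
    rewrite lerXn2r ?nnegrE ?wnorm_ge0 ?(mulr_ge0 C0 (exprn_ge0 5 (ltW h0))) //.
    rewrite tS; apply: HC => //; first by rewrite (ltW h0).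
      by rewrite -tS; exact: Hw.
    by move=> s; rewrite -tS => st; exact: bw.
  apply: lerD.
    apply: le_trans (ler_wpM2l _ ef) _; first by rewrite addr_ge0 ?(ltW h0).
    rewrite mulrA ler_wpM2r ?energy_ge0 //.
    have -> : lam * h = h + 2 * K * h by rewrite /lam; ring.
    by rewrite expRD ler_wpM2r ?expR_ge0 // expR_ge1Dx.
  (* [1 + h^-1] turns the squared local error of order ten into order nine. *)
  have hi : 1 + h^-1 <= 2 * h^-1.
    have : 1 <= h^-1 by rewrite invf_ge1.
    lra.
  apply: le_trans (ler_wpM2r _ hi) _; first exact: energy_ge0.
  apply: le_trans (ler_wpM2l _ eg) _; first by rewrite mulr_ge0 // invr_ge0 ltW.
  rewrite le_eqVlt; apply/orP; left; apply/eqP.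
  by field; rewrite gt_eqF.
move=> n nM.
have lam0 : 0 <= lam by rewrite /lam addr_ge0 // mulr_ge0.
have r0 : 0 <= 2 * C ^+ 2 * h ^+ 9 by rewrite !mulr_ge0 ?sqr_ge0 ?exprn_ge0 // ltW.
apply: le_trans (discrete_gronwall lam0 (ltW h0) r0 e0 step nM) _.
have -> : n%:R * (2 * C ^+ 2 * h ^+ 9) = t n * (2 * C ^+ 2) * h ^+ 8 by rewrite /t; ring.
have -> : T * (2 * C ^+ 2) * expR (lam * T) * h ^+ 8 =
   T * (2 * C ^+ 2) * h ^+ 8 * expR (lam * T) by ring.
have h8 := exprn_ge0 8 (ltW h0).
have C2 : 0 <= 2 * C ^+ 2 by rewrite mulr_ge0 ?sqr_ge0.
apply: ler_pM (expR_ge0 _) _ _.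
- exact: mulr_ge0 (mulr_ge0 (t0 n) C2) h8.
- by apply: ler_wpM2r h8 _ _ _; apply: ler_wpM2r C2 _ _ _; exact: tM.
- by rewrite ler_expR; apply: ler_wpM2l lam0 _ _ _; exact: tM.
Qed.

End Convergence.

(** * Integrals of trigonometric polynomials over the torus *)

Section Integrals.
Variable R : realType.
Local Notation plane := (measurableTypeR R * measurableTypeR R)%type.
Local Notation mu := (@lebesgue_measure R).
Local Notation leb2 := (@leb2 R).
Local Notation Omega := (@Omega R).
Local Notation J := (`[- pi, pi]%classic : set (measurableTypeR R)).

Lemma J_measurable : measurable J. Proof. exact: measurable_itv. Qed.

Lemma mu_J : mu J = (2 * pi)%:E.
Proof.
rewrite lebesgue_measure_itv /= lte_fin gtrN ?pi_gt0 // -EFinB.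
by congr EFin; ring.
Qed.

Lemma Omega_measurable : measurable Omega.
Proof. by apply: measurableX; exact: J_measurable. Qed.

Lemma leb2_Omega : leb2 Omega = ((2 * pi) ^+ 2)%:E.
Proof.
rewrite /leb2 /Defs.leb2 /= product_measure1E; [|exact: J_measurable|exact: J_measurable].
transitivity ((2 * pi)%:E * (2 * pi)%:E : \bar R)%E; last by rewrite -EFinM -expr2.
by congr (_ * _)%E; exact: mu_J.
Qed.

(** Bounded measurable functions, a class closed under sums that contains the
    real trigonometric polynomials and consists of integrable functions. *)
Definition bmeas d (T : measurableType d) (f : T -> R) : Prop :=
  measurable_fun [set: T] f /\ exists M, forall x, `|f x| <= M.

Lemma bmeas_integrable (f : plane -> R) : bmeas f -> leb2.-integrable Omega (EFin \o f).
Proof.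
move=> [mf [M fM]]; apply: measurable_bounded_integrable.
- exact: Omega_measurable.
- by rewrite leb2_Omega ltry.
- exact: measurable_funTS.
- exists M; split; first exact: num_real.
  by move=> r Mr x _; apply: le_trans (fM x) (ltW Mr).
Qed.

Lemma bmeas_cst d (T : measurableType d) (r : R) : bmeas (fun _ : T => r).
Proof. by split; [exact: measurable_cst|exists `|r|]. Qed.

Lemma bmeasD d (T : measurableType d) (f g : T -> R) : bmeas f -> bmeas g ->
  bmeas (fun x => f x + g x).
Proof.
move=> [mf [M fM]] [mg [M' gM]]; split; first exact: measurable_realfun.measurable_funD.
by exists (M + M') => x; apply: le_trans (ler_normD _ _) _; rewrite lerD.
Qed.

Lemma bmeasM d (T : measurableType d) (f g : T -> R) : bmeas f -> bmeas g ->
  bmeas (fun x => f x * g x).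
Proof.
move=> [mf [M fM]] [mg [M' gM]]; split; first exact: measurable_realfun.measurable_funM.
by exists (M * M') => x; rewrite normrM ler_pM.
Qed.

Lemma bmeasZ d (T : measurableType d) (r : R) (f : T -> R) : bmeas f ->
  bmeas (fun x => r * f x).
Proof. by move=> bf; apply: bmeasM bf; exact: bmeas_cst. Qed.

Lemma bmeas_sum d (T : measurableType d) (I : Type) (s : seq I) (f : I -> T -> R) :
  (forall i, bmeas (f i)) -> bmeas (fun x => \sum_(i <- s) f i x).
Proof.
move=> H; elim: s => [|i s IH].
  by rewrite (_ : (fun x => _) = fun=> 0); [exact: bmeas_cst|apply/funext => x; rewrite big_nil].
rewrite (_ : (fun x => _) = fun x => f i x + \sum_(j <- s) f j x); first exact: bmeasD.
by apply/funext => x; rewrite big_cons.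
Qed.

Lemma intOD (f g : plane -> R) : bmeas f -> bmeas g ->
  intO (fun x => f x + g x) = intO f + intO g.
Proof.
move=> bf bg; rewrite /intO RintegralD //; [exact: Omega_measurable| |];
  exact: bmeas_integrable.
Qed.

Lemma intOZ (r : R) (f : plane -> R) : bmeas f -> intO (fun x => r * f x) = r * intO f.
Proof.
move=> bf; rewrite /intO RintegralZl //; [exact: Omega_measurable|exact: bmeas_integrable].
Qed.

Lemma intO0 : intO (fun _ : plane => 0 : R) = 0.
Proof.
by have := intOZ 0 (bmeas_cst _ (0 : R)); rewrite !mul0r.
Qed.

Lemma intO_sum (I : Type) (s : seq I) (f : I -> plane -> R) :
  (forall i, bmeas (f i)) ->
  intO (fun x => \sum_(i <- s) f i x) = \sum_(i <- s) intO (f i).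
Proof.
move=> H; elim: s => [|i s IH].
  rewrite big_nil (_ : (fun x => _) = fun=> 0) ?intO0 //.
  by apply/funext => x; rewrite big_nil.
rewrite big_cons -IH -intOD //; last exact: bmeas_sum.
by congr intO; apply/funext => x; rewrite big_cons.
Qed.

Local Open Scope ereal_scope.

(** Fubini's theorem for separated variables. *)
Lemma intO_prod (g1 g2 : measurableTypeR R -> R) : bmeas g1 -> bmeas g2 ->
  intO (fun x : plane => g1 x.1 * g2 x.2)%R =
  ((\int[mu]_(x in J) g1 x) * (\int[mu]_(x in J) g2 x))%R.
Proof.
move=> b1 b2.
have bi (g : measurableTypeR R -> R) : bmeas g -> mu.-integrable J (EFin \o g).
  move=> [mg [M gM]]; apply: measurable_bounded_integrable.
  - exact: J_measurable.
  - apply: (@le_lt_trans _ _ ((2 * pi)%:E)); last exact: ltry.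
    by rewrite le_eqVlt; apply/orP; left; apply/eqP; exact: mu_J.
  - exact: measurable_funTS.
  - exists M; split; first exact: num_real.
    by move=> r Mr x _; apply: le_trans (gM x) (ltW Mr).
have i1 := bi _ b1; have i2 := bi _ b2.
pose G (x : plane) : R := (g1 x.1 * g2 x.2)%R.
have bG : bmeas G.
  have [m1 [M1 h1]] := b1; have [m2 [M2 h2]] := b2.
  split; last by exists (M1 * M2)%R => x; rewrite normrM ler_pM.
  by apply: measurable_realfun.measurable_funM; apply: measurableT_comp.
have iG := bmeas_integrable bG.
rewrite /intO /Rintegral integral_mkcond.
have iG' : leb2.-integrable setT ((EFin \o G) \_ Omega).
  by apply/integrable_restrict; rewrite ?setTI //; exact: Omega_measurable.
have e1 : \int[leb2]_x ((fun x => (g1 x.1 * g2 x.2)%:E) \_ Omega) x =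
  \int[mu]_x \int[mu]_y ((EFin \o G) \_ Omega) (x, y).
  by rewrite (integral12_prod_meas1 (m1 := mu) (m2 := mu) iG').
rewrite e1.
have f2 : \int[mu]_(y in J) (g2 y)%:E \is a fin_num by exact: integrable_fin_num.
have e2 x : \int[mu]_y ((EFin \o G) \_ Omega) (x, y) =
   ((fun x => (\int[mu]_(y in J) (g2 y)%:E) * (g1 x)%:E) \_ J) x.
  rewrite patchE; case: ifPn => [xJ|xJ].
    rewrite muleC -(integralZl J_measurable i2).
    rewrite [RHS]integral_mkcond; apply: eq_integral => y _.
    rewrite !patchE; have -> : ((x, y) \in Omega) = (y \in J).
      apply/idP/idP; rewrite !inE /Omega /=; first by case.
      by move=> yJ; split => //; move: xJ; rewrite inE.
    by case: ifPn => // _; rewrite /G /= EFinM.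
  rewrite integral0_eq // => y _; rewrite patchE; case: ifPn => // ; rewrite inE => -[] /= h _.
  by move: xJ; rewrite notin_setE.
rewrite (eq_integral _ _ (fun x _ => e2 x)) -integral_mkcond.
rewrite -(fineK f2) (integralZl J_measurable i1).
have f1 : \int[mu]_(y in J) (g1 y)%:E \is a fin_num by exact: integrable_fin_num.
by rewrite -(fineK f1) -EFinM /= mulrC.
Qed.

Local Close Scope ereal_scope.

Lemma sin_int_pi (m : int) : sin (m%:~R * pi : R) = 0.
Proof.
have H (n : nat) : sin (n%:R * pi : R) = 0.
  elim: n => [|n IH]; first by rewrite mul0r sin0.
  by rewrite -natr1 mulrDl mul1r sinDpi IH oppr0.
case: m => n; first exact: H.
by rewrite NegzE mulrNz mulNr sinN (H n.+1) oppr0.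
Qed.

Lemma is_derive_scaled (F f : R -> R) (r x : R) :
  (forall y : R, is_derive y 1 F (f y)) ->
  is_derive x 1 (fun t : R => F (r * t)) (r * f (r * x)).
Proof.
move=> H.
have D : is_derive x 1 (fun t : R => r * t) r.
  have := is_deriveM (is_derive_cst r x (1 : R)) (is_derive_id x (1 : R)).
  by move=> D; apply: (is_derive_eq D); rewrite /GRing.scale /= mulr0 addr0 mulr1.
have D' := @is_derive1_comp _ F (fun t : R => r * t) x _ _ (H (r * x)) D.
by apply: (is_derive_eq D'); rewrite mulrC.
Qed.

Lemma Rintegral_FTC (F f : R -> R) : (forall x : R, is_derive x 1 F (f x)) ->
  continuous f -> \int[mu]_(x in J) f x = F pi - F (- pi).
Proof.
move=> H cf; rewrite /Rintegral (@continuous_FTC2 R f F (- pi) pi) //.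
- by rewrite gtrN ?pi_gt0.
- exact: continuous_subspaceT.
- have cF : continuous F.
    by move=> x; apply/differentiable_continuous/derivable1_diffP; case: (H x).
  split.
  + by move=> x _; case: (H x).
  + exact/cvg_at_right_filter/cF.
  + exact/cvg_at_left_filter/cF.
- by move=> x _; rewrite derive1E; case: (H x).
Qed.

Lemma Rintegral_cos (m : int) :
  \int[mu]_(x in J) cos (m%:~R * x) = 2 * pi * (m == 0)%:R.
Proof.
have cc : continuous (fun x : R => cos (m%:~R * x)).
  move=> x; apply: continuous_comp; last exact: continuous_cos.
  exact: mulrl_continuous.
have [m0|m0] := eqVneq m 0.
  have D (x : R) : is_derive x 1 id (cos (m%:~R * x)).
    by rewrite m0 mul0r cos0; exact: is_derive_id.
  by rewrite (Rintegral_FTC D cc) mulr1; ring.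
have mR : m%:~R != 0 :> R by rewrite intr_eq0.
have D (x : R) : is_derive x 1 (fun x => m%:~R^-1 * sin (m%:~R * x)) (cos (m%:~R * x)).
  have D := is_derive_scaled (m%:~R) x (@is_derive_sin R).
  have D' := is_deriveM (is_derive_cst (m%:~R^-1 : R) x (1 : R)) D.
  apply: (is_derive_eq D').
  by rewrite /GRing.scale /= mulr0 addr0 mulrA mulVf // mul1r.
by rewrite (Rintegral_FTC D cc) mulrN sinN sin_int_pi oppr0 subrr mulr0.
Qed.

Lemma Rintegral_sin (m : int) : \int[mu]_(x in J) sin (m%:~R * x) = 0.
Proof.
have cc : continuous (fun x : R => sin (m%:~R * x)).
  move=> x; apply: continuous_comp; last exact: continuous_sin.
  exact: mulrl_continuous.
have [m0|m0] := eqVneq m 0.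
  have D (x : R) : is_derive x 1 (fun=> 0) (sin (m%:~R * x)).
    by rewrite m0 mul0r sin0; exact: is_derive_cst.
  by rewrite (Rintegral_FTC D cc) subrr.
have mR : m%:~R != 0 :> R by rewrite intr_eq0.
have D (x : R) : is_derive x 1 (fun x => - m%:~R^-1 * cos (m%:~R * x)) (sin (m%:~R * x)).
  have D := is_derive_scaled (m%:~R) x (@is_derive_cos R).
  have D' := is_deriveM (is_derive_cst (- m%:~R^-1 : R) x (1 : R)) D.
  apply: (is_derive_eq D').
  by rewrite /GRing.scale /= mulr0 addr0 mulrA mulNr mulVf // mulN1r opprK.
by rewrite (Rintegral_FTC D cc) mulrN cosN subrr.
Qed.

Lemma bmeas_cos (m : int) : bmeas (fun x : measurableTypeR R => cos (m%:~R * x)).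
Proof.
split; last by exists 1 => x; rewrite ler_norml cos_geN1 cos_le1.
apply: measurable_realfun.continuous_measurable_fun => x.
apply: continuous_comp; last exact: continuous_cos.
exact: mulrl_continuous.
Qed.

Lemma bmeas_sin (m : int) : bmeas (fun x : measurableTypeR R => sin (m%:~R * x)).
Proof.
split; last by exists 1 => x; rewrite ler_norml sin_geN1 sin_le1.
apply: measurable_realfun.continuous_measurable_fun => x.
apply: continuous_comp; last exact: continuous_sin.
exact: mulrl_continuous.
Qed.

Lemma modeE (k : freq) (x : plane) : mode k x = cis (dot k x).
Proof. exact: Cexp_i. Qed.

Lemma bmeas_prod (g1 g2 : measurableTypeR R -> R) : bmeas g1 -> bmeas g2 ->
  bmeas (fun x : plane => g1 x.1 * g2 x.2).
Proof.
move=> [m1 [M1 h1]] [m2 [M2 h2]].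
split; last by exists (M1 * M2) => x; rewrite normrM ler_pM.
by apply: measurable_realfun.measurable_funM; apply: measurableT_comp.
Qed.

Lemma Re_mode (k : freq) (x : plane) : cRe (mode k x) =
  cos (k.1%:~R * x.1) * cos (k.2%:~R * x.2) + -1 * (sin (k.1%:~R * x.1) * sin (k.2%:~R * x.2)).
Proof. by rewrite modeE /= cosD mulN1r. Qed.

Lemma Im_mode (k : freq) (x : plane) : cIm (mode k x) =
  sin (k.1%:~R * x.1) * cos (k.2%:~R * x.2) + cos (k.1%:~R * x.1) * sin (k.2%:~R * x.2).
Proof. by rewrite modeE /= sinD. Qed.

Lemma bmeas_Re_mode (k : freq) : bmeas (fun x : plane => cRe (mode k x)).
Proof.
under eq_fun do rewrite Re_mode.
exact: bmeasD (bmeas_prod (bmeas_cos k.1) (bmeas_cos k.2))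
  (bmeasZ (-1) (bmeas_prod (bmeas_sin k.1) (bmeas_sin k.2))).
Qed.

Lemma bmeas_Im_mode (k : freq) : bmeas (fun x : plane => cIm (mode k x)).
Proof.
under eq_fun do rewrite Im_mode.
exact: bmeasD (bmeas_prod (bmeas_sin k.1) (bmeas_cos k.2))
  (bmeas_prod (bmeas_cos k.1) (bmeas_sin k.2)).
Qed.

Lemma intOC_mode (k : freq) :
  intOC (fun x : plane => mode k x) = (((2 * pi) ^+ 2)%:C * (k == 0)%:R : R[i]).
Proof.
have cc := bmeas_prod (bmeas_cos k.1) (bmeas_cos k.2).
have ss := bmeas_prod (bmeas_sin k.1) (bmeas_sin k.2).
have sc := bmeas_prod (bmeas_sin k.1) (bmeas_cos k.2).
have cs := bmeas_prod (bmeas_cos k.1) (bmeas_sin k.2).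
have eR : intO (fun x : plane => cRe (mode k x)) = (2 * pi) ^+ 2 * (k == 0)%:R.
  under eq_fun do rewrite Re_mode.
  rewrite (intOD cc (bmeasZ (-1) ss)) (intOZ _ ss).
  rewrite (intO_prod (bmeas_cos k.1) (bmeas_cos k.2)).
  rewrite (intO_prod (bmeas_sin k.1) (bmeas_sin k.2)) !Rintegral_cos !Rintegral_sin.
  have -> : (k == 0) = (k.1 == 0) && (k.2 == 0) by case: k {cc ss sc cs}.
  by rewrite -mulnb natrM; ring.
have eI : intO (fun x : plane => cIm (mode k x)) = 0.
  under eq_fun do rewrite Im_mode.
  rewrite (intOD sc cs).
  rewrite (intO_prod (bmeas_sin k.1) (bmeas_cos k.2)).
  by rewrite (intO_prod (bmeas_cos k.1) (bmeas_sin k.2)) !Rintegral_sin mulr0 mul0r addr0.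
by rewrite /intOC eR eI complexr0 rmorphM rmorph_nat.
Qed.

Lemma modeD (k l : freq) (x : plane) : mode (k + l : int * int) x = mode k x * mode l x.
Proof.
rewrite !modeE -cisD; congr cis; rewrite /dot /= !intrD; ring.
Qed.

Lemma modeN (k : freq) (x : plane) : mode (- k : int * int) x = conjc (mode k x).
Proof. by rewrite !modeE -cisN; congr cis; rewrite /dot /= !mulrNz; ring. Qed.

Lemma intOC_sum (I : Type) (s : seq I) (c : I -> R[i]) (phi : I -> freq) :
  intOC (fun x : plane => \sum_(i <- s) c i * mode (phi i) x) =
  ((2 * pi) ^+ 2)%:C * \sum_(i <- s) c i * (phi i == 0)%:R.
Proof.
transitivity (\sum_(i <- s) c i * intOC (fun x : plane => mode (phi i) x)); last first.
  rewrite mulr_sumr; apply: eq_bigr => i _; rewrite intOC_mode mulrCA.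
  by congr (_ * _).
have bR i := bmeas_Re_mode (phi i); have bI i := bmeas_Im_mode (phi i).
apply: complexP.
  rewrite cRe_sum /=; under eq_fun do rewrite cRe_sum.
  rewrite intO_sum; last first.
    move=> i; under eq_fun do rewrite cReM -mulNr.
    by apply: bmeasD; apply: bmeasZ.
  apply: eq_bigr => i _; under eq_fun do rewrite cReM -mulNr.
  rewrite intOD; [|by apply: bmeasZ|by apply: bmeasZ].
  by rewrite !intOZ // cReM mulNr.
rewrite cIm_sum /=; under eq_fun do rewrite cIm_sum.
rewrite intO_sum; last first.
  move=> i; under eq_fun do rewrite cImM.
  by apply: bmeasD; apply: bmeasZ.
apply: eq_bigr => i _; under eq_fun do rewrite cImM.
rewrite intOD; [|by apply: bmeasZ|by apply: bmeasZ].
by rewrite !intOZ // cImM.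
Qed.

End Integrals.

(** * Trigonometric polynomials and their Fourier coefficients *)

Section TrigonometricPolynomials.
Variable R : realType.
Local Notation plane := (measurableTypeR R * measurableTypeR R)%type.
Implicit Types (N : nat) (f g : plane -> R) (c : freq -> R[i]).
Local Notation Z2 := (int * int)%type.

Lemma freqs_opp N (k : freq) : k \in freqs N -> (- k : Z2) \in freqs N.
Proof. by rewrite !mem_freqs /= !abszN. Qed.

Lemma freqs_add N N' (k l : freq) : k \in freqs N -> l \in freqs N' ->
  (k + l : Z2) \in freqs (N + N').
Proof. by rewrite !mem_freqs !geq_max /= => /andP[? ?] /andP[? ?]; apply/andP; split; lia. Qed.

Lemma sum_delta (I : eqType) (F : seq I) (k : I) (c : I -> R[i]) : uniq F ->
  \sum_(l <- F) c l * (l == k)%:R = if k \in F then c k else 0.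
Proof.
move=> uF; case: ifPn => kF.
  by rewrite (bigD1_seq k) //= eqxx mulr1 big1 ?addr0 // => l /negPf ->; rewrite mulr0.
rewrite big_seq big1 // => l lF; case: eqP => [e|_]; last by rewrite mulr0.
by rewrite -e lF in kF.
Qed.

Definition has_coef N f c := forall x, (f x)%:C = \sum_(k <- freqs N) c k * mode k x.

(** Orthogonality of the exponentials. *)
Lemma fhat_coef N f c (k : freq) : has_coef N f c ->
  fhat f k = if k \in freqs N then c k else 0.
Proof.
move=> H; rewrite /fhat.
have -> : intOC (fun x => (f x)%:C * Cexp (- ('i * (dot k x)%:C))) =
    intOC (fun x : plane => \sum_(l <- freqs N) c l * mode (l - k : Z2) x).
  congr intOC; apply/funext => x; rewrite H mulr_suml; apply: eq_bigr => l _.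
  rewrite modeD modeN mulrA; congr (_ * _).
  by rewrite modeE -cisN -Cexp_i rmorphN mulrN.
rewrite intOC_sum mulrA -rmorphM /= mulVf ?mul1r; last first.
  by rewrite expf_neq0 // mulf_neq0 ?pnatr_eq0 // gt_eqF // pi_gt0.
rewrite -(sum_delta k c (freqs_uniq N)); apply: eq_bigr => l _.
by rewrite subr_eq0.
Qed.

Lemma XN_coef N f : XN N f -> has_coef N f (fhat f).
Proof.
move=> [c H] x; rewrite H !big_seq; apply: eq_bigr => k kF.
by rewrite (fhat_coef k H) kF.
Qed.

Lemma fhat_out N f (k : freq) : XN N f -> k \notin freqs N -> fhat f k = 0.
Proof. by move=> [c H] kF; rewrite (fhat_coef k H) (negPf kF). Qed.

Lemma big_freqs_opp N (F : freq -> R[i]) :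
  \sum_(k <- freqs N) F (- k : Z2) = \sum_(k <- freqs N) F k.
Proof. exact: (big_sym (freqs_uniq N) (@freqs_opp N)). Qed.

Lemma fhat_opp N f (k : freq) : XN N f -> fhat f (- k : Z2) = conjc (fhat f k).
Proof.
move=> [c H].
have H' : has_coef N f (fun l => conjc (c (- l : Z2))).
  move=> x; rewrite -cJ_real H cJ_sum -big_freqs_opp; apply: eq_bigr => l _.
  by rewrite cJM modeN cJK.
rewrite (fhat_coef _ H) (fhat_coef k H'); have -> : ((- k : Z2) \in freqs N) = (k \in freqs N).
  by apply/idP/idP => /freqs_opp //; rewrite opprK.
case: ifP => _; first by rewrite cJK.
by apply: complexP; rewrite /= ?oppr0.
Qed.

(** Conjugation exchanges the terms of opposite frequencies. *)
Lemma trig_real N c x : (forall k, k \in freqs N -> c (- k : Z2) = conjc (c k)) ->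
  (cRe (\sum_(k <- freqs N) c k * mode k x))%:C = \sum_(k <- freqs N) c k * mode k x.
Proof.
move=> H; set s := \sum_(k <- _) _.
have : conjc s = s.
  rewrite /s cJ_sum -[RHS]big_freqs_opp !big_seq; apply: eq_bigr => k kF.
  by rewrite cJM H // modeN.
case: s => a b [] /eqP; rewrite eq_sym -subr_eq0 opprK -mulr2n mulrn_eq0 /= => /eqP ->.
by [].
Qed.

Lemma trig_has_coef N c : (forall k, k \in freqs N -> c (- k : Z2) = conjc (c k)) ->
  has_coef N (fun x => cRe (\sum_(k <- freqs N) c k * mode k x)) c.
Proof. by move=> H x; rewrite trig_real. Qed.

Lemma has_coefB N f g c c' : has_coef N f c -> has_coef N g c' ->
  has_coef N (fun x => f x - g x) (fun k => c k - c' k).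
Proof.
move=> H H' x; rewrite rmorphB /= H H' -sumrB; apply: eq_bigr => k _.
by rewrite mulrBl.
Qed.

Lemma has_coefD N f g c c' : has_coef N f c -> has_coef N g c' ->
  has_coef N (fun x => f x + g x) (fun k => c k + c' k).
Proof.
move=> H H' x; rewrite rmorphD /= H H' -big_split; apply: eq_bigr => k _.
by rewrite mulrDl.
Qed.

Lemma has_coefZ N (r : R) f c : has_coef N f c ->
  has_coef N (fun x => r * f x) (fun k => r%:C * c k).
Proof.
move=> H x; rewrite rmorphM /= H mulr_sumr; apply: eq_bigr => k _.
by rewrite mulrA.
Qed.

Lemma has_coef_XN N f c : has_coef N f c -> XN N f.
Proof. by move=> H; exists c. Qed.

Lemma XN_widen N N' f : (N <= N')%N -> XN N f -> XN N' f.
Proof.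
move=> NN /[dup] XNf /XN_coef H; exists (fhat f) => x; rewrite H.
have sub k : k \in freqs N -> k \in freqs N'.
  by rewrite !mem_freqs => /leq_trans; apply.
rewrite [RHS](bigID (fun k => k \in freqs N)) /= [X in _ = _ + X]big1 ?addr0; last first.
  by move=> k kF; rewrite (fhat_out XNf kF) mul0r.
rewrite -[RHS]big_filter; apply: perm_big; apply: uniq_perm.
- exact: freqs_uniq.
- exact/filter_uniq/freqs_uniq.
by move=> k; rewrite mem_filter; case: (boolP (k \in freqs N)) => //= /sub ->.
Qed.

Lemma XN_inj N f g : XN N f -> XN N g ->
  (forall k, k \in freqs N -> fhat f k = fhat g k) -> f = g.
Proof.
move=> /XN_coef Hf /XN_coef Hg e; apply/funext => x; apply: complexI.
by rewrite Hf Hg !big_seq; apply: eq_bigr => k /e ->.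
Qed.

(** Parseval's identity. For real functions the conjugate of a coefficient is the
    coefficient of the opposite frequency. *)
Lemma inner_XN N N' f g : XN N f -> XN N' g ->
  (inner f g)%:C = ((2 * pi) ^+ 2)%:C * \sum_(k <- freqs N) fhat f k * fhat g (- k : Z2).
Proof.
move=> Xf Xg; have Hf := XN_coef Xf; have Hg := XN_coef Xg.
pose s := [seq (k, l) | k <- freqs N, l <- freqs N'].
have -> : (inner f g)%:C = intOC (fun x => \sum_(p <- s)
    (fhat f p.1 * fhat g p.2) * mode (p.1 + p.2 : Z2) x).
  have E x : \sum_(p <- s) (fhat f p.1 * fhat g p.2) * mode (p.1 + p.2 : Z2) x = (f x * g x)%:C.
    rewrite rmorphM /= Hf Hg big_allpairs_dep mulr_suml; apply: eq_bigr => k _.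
    by rewrite mulr_sumr; apply: eq_bigr => l _; rewrite modeD /=; ring.
  rewrite /intOC /inner; apply: complexP => /=.
    by congr intO; apply/funext => x; rewrite E.
  by rewrite -[LHS]intO0; congr intO; apply/funext => x; rewrite E.
rewrite intOC_sum big_allpairs_dep; congr (_ * _); apply: eq_bigr => k _ /=.
have -> : \sum_(l <- freqs N') fhat f k * fhat g l * ((k + l : Z2) == 0)%:R =
  fhat f k * \sum_(l <- freqs N') fhat g l * (l == (- k : Z2))%:R.
  rewrite mulr_sumr; apply: eq_bigr => l _.
  have -> : ((k + l : Z2) == 0) = (l == (- k : Z2)) by rewrite addrC addr_eq0.
  by rewrite mulrA.
rewrite sum_delta ?freqs_uniq //; case: ifPn => // kF.
by rewrite (fhat_out Xg kF).
Qed.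

Lemma innerC f g : inner f g = inner g f.
Proof. by congr intO; apply/funext => x; rewrite mulrC. Qed.

Lemma inner_XNr N N' f g : XN N' f -> XN N g ->
  (inner f g)%:C = ((2 * pi) ^+ 2)%:C * \sum_(k <- freqs N) fhat f k * fhat g (- k : Z2).
Proof.
move=> Xf Xg; rewrite innerC (inner_XN Xg Xf) -big_freqs_opp; congr (_ * _).
by apply: eq_bigr => k _; rewrite opprK mulrC.
Qed.

Lemma inner_self N f : XN N f -> inner f f = (2 * pi) ^+ 2 * energy (freqs N) (fhat f).
Proof.
move=> Xf; apply: complexI; rewrite (inner_XN Xf Xf) [in RHS]rmorphM /=; congr (_ * _).
rewrite /energy real_complexS; apply: eq_bigr => k _.
by rewrite (fhat_opp k Xf) cn_mulJ.
Qed.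

Lemma L2norm_XN N f : XN N f ->
  L2norm f = 2 * pi * Num.sqrt (energy (freqs N) (fhat f)).
Proof.
move=> Xf; rewrite /L2norm (inner_self Xf) sqrtrM ?sqr_ge0 // sqrtr_sqr ger0_norm //.
by rewrite mulr_ge0 // ltW // pi_gt0.
Qed.

Lemma fmult_has_coef N (m : freq -> R[i]) f : XN N f ->
  (forall k, m (- k : Z2) = conjc (m k)) ->
  has_coef N (fmult N m f) (fun k => m k * fhat f k).
Proof.
by move=> Xf H; apply: trig_has_coef => k _; rewrite H (fhat_opp k Xf) -cJM.
Qed.

Lemma Dx1_has_coef N f : XN N f ->
  has_coef N (Dx1 f) (fun k => 'i * k.1%:~R * fhat f k).
Proof.
move=> Xf; have Hf := XN_coef Xf.
pose a k : R := cRe (fhat f k). pose b k : R := cIm (fhat f k).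
have Ef y : f y = \sum_(k <- freqs N) (a k * cos (dot k y) - b k * sin (dot k y)).
  have := congr1 (fun z => cRe z) (Hf y); rewrite /= cRe_sum => ->.
  by apply: eq_bigr => k _; rewrite cReM modeE.
have E x : Dx1 f x = cRe (\sum_(k <- freqs N) 'i * k.1%:~R * fhat f k * mode k x).
  rewrite /Dx1 derive1E.
  pose G s := \sum_(k <- freqs N) (a k * cos (dot k (s, x.2)) - b k * sin (dot k (s, x.2))).
  pose dG s := \sum_(k <- freqs N) (a k * - (k.1%:~R * sin (dot k (s, x.2)))
                                 - b k * (k.1%:~R * cos (dot k (s, x.2)))).
  have D : rder (x.1 - 1) (x.1 + 1) G dG.
    apply: rder_sum => k _; have Dd (s : R) : is_derive s 1 (fun s : R => dot k (s, x.2)) (k.1%:~R).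
      have := is_deriveD (is_deriveM (is_derive_cst (k.1%:~R : R) s (1 : R)) (is_derive_id s (1 : R)))
        (is_derive_cst (k.2%:~R * x.2 : R) s (1 : R)).
      move=> D; apply: (is_derive_eq D).
      by rewrite /GRing.scale /= mulr0 !addr0 mulr1.
    apply: rderD; [|apply: rderN]; apply: rderZ; apply: rder_global => s.
      have D := @is_derive1_comp _ cos (fun s : R => dot k (s, x.2)) s _ _ (is_derive_cos _) (Dd s).
      by apply: (is_derive_eq D); rewrite mulNr mulrC.
    have D := @is_derive1_comp _ sin (fun s : R => dot k (s, x.2)) s _ _ (is_derive_sin _) (Dd s).
    by apply: (is_derive_eq D); rewrite mulrC.
  have [_ /(_ x.1)] := D; rewrite in_itv /= ltrBlDr ltrDl ltr01 => /(_ isT) [_ dE].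
  have -> : (fun s => f (s, x.2)) = G by apply/funext => s; exact: Ef.
  rewrite dE /dG cRe_sum; apply: eq_bigr => k _.
  have -> : dot k (x.1, x.2) = dot k x by case: (x).
  have -> : (k.1%:~R : R[i]) = (k.1%:~R)%:C by rewrite rmorph_int.
  by rewrite /a /b; case: (fhat f k) => p q; rewrite modeE !cReM !cImM /=; ring.
move=> x; rewrite E; apply: trig_real => k _.
rewrite (fhat_opp k Xf); have -> : ((- k : Z2).1) = - k.1 by [].
rewrite mulrNz.
have -> : (k.1%:~R : R[i]) = (k.1%:~R)%:C by rewrite rmorph_int.
by move: (fhat f k) => z; rewrite !cJM cJ_real cJi; ring.
Qed.

End TrigonometricPolynomials.

(** * The scheme in Fourier coefficients *)

Section SchemeCoefficients.
Variable R : realType.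
Local Notation plane := (measurableTypeR R * measurableTypeR R)%type.
Implicit Types (N : nat) (f g : plane -> R) (c : freq -> R[i]).
Local Notation Z2 := (int * int)%type.

Definition ellsym (alpha : R) (k : freq) : R := k.1%:~R * len R k `^ alpha.
Definition dsym (k : freq) : R := - 2^-1 * k.1%:~R.

Lemma eq_has_coef N f c c' : (forall k, k \in freqs N -> c k = c' k) ->
  has_coef N f c -> has_coef N f c'.
Proof. by move=> e H x; rewrite H !big_seq; apply: eq_bigr => k /e ->. Qed.

Lemma has_coef_fhat N f c (k : freq) : has_coef N f c -> k \in freqs N -> fhat f k = c k.
Proof. by move=> H kF; rewrite (fhat_coef k H) kF. Qed.

(** The square has frequencies up to [2 N], where no product is truncated. *)
Lemma has_coef_sqr N f : XN N f ->
  has_coef (N + N) (fun x => f x ^+ 2) (tconv (freqs N) (fhat f) (fhat f)).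
Proof.
move=> Xf x; have Hf := XN_coef Xf.
rewrite expr2 rmorphM /= Hf mulr_suml.
rewrite /tconv; under [RHS]eq_bigr => k _ do rewrite mulr_suml.
rewrite [RHS]exchange_big !big_seq; apply: eq_bigr => j jF /=.
under [RHS]eq_bigr => k _ do rewrite mulr_suml.
rewrite mulr_sumr [RHS]exchange_big !big_seq; apply: eq_bigr => l lF /=.
have -> : \sum_(k <- freqs (N + N)) ((j : Z2) + l == k)%:R * (fhat f j * fhat f l) * mode k x =
   fhat f j * fhat f l * \sum_(k <- freqs (N + N)) mode k x * (k == ((j : Z2) + l))%:R.
  by rewrite mulr_sumr; apply: eq_bigr => k _; rewrite [_ == k]eq_sym; ring.
rewrite sum_delta ?freqs_uniq // freqs_add // modeD; ring.
Qed.

Lemma XN_cst0 N : XN N (fun _ : plane => 0 : R).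
Proof. by exists (fun=> 0) => x; rewrite big1 // => k _; rewrite mul0r. Qed.

Lemma PiN_XN N f : XN N (PiN N f).
Proof. by rewrite /PiN; case: xgetP => [y -> [] //|_]; exact: XN_cst0. Qed.

Lemma XNB N N' f g : XN N f -> XN N' g ->
  has_coef (N + N') (fun x => f x - g x) (fun k => fhat f k - fhat g k).
Proof.
move=> Xf Xg; apply: has_coefB; apply: XN_coef.
  by apply: XN_widen Xf; rewrite leq_addr.
by apply: XN_widen Xg; rewrite leq_addl.
Qed.

Lemma fhatB N N' f g (k : freq) : XN N f -> XN N' g ->
  fhat (fun x => f x - g x) k = fhat f k - fhat g k.
Proof.
move=> Xf Xg; rewrite (fhat_coef k (XNB Xf Xg)); case: ifPn => // kF.
have out (M : nat) (h : plane -> R) : (M <= N + N')%N -> XN M h -> fhat h k = 0.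
  move=> MN Xh; apply: (fhat_out Xh); apply: contra kF; rewrite !mem_freqs => kM.
  exact: leq_trans kM MN.
by rewrite (out _ _ (leq_addr _ _) Xf) (out _ _ (leq_addl _ _) Xg) subrr.
Qed.

Lemma energy_eq0 (F : seq freq) (c : freq -> R[i]) (k : freq) :
  energy F c = 0 -> k \in F -> c k = 0.
Proof.
move=> e kF; apply: eq0_normc; apply/eqP; rewrite -sqrf_eq0.
move: e; rewrite /energy (big_rem k) //= => /eqP.
by rewrite paddr_eq0 ?sqr_ge0 ?sumr_ge0 // => [/andP[]|i _]; rewrite ?sqr_ge0.
Qed.

(** On trigonometric polynomials of higher degree the projection is the
    truncation of the Fourier series. *)
Lemma PiN_has_coef N N' g : XN N' g -> has_coef N (PiN N g) (fhat g).
Proof.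
move=> Xg.
pose p (x : plane) : R := cRe (\sum_(k <- freqs N) fhat g k * mode k x).
have Hp : has_coef N p (fhat g) by apply: trig_has_coef => k _; exact: (fhat_opp k Xg).
have Xp := has_coef_XN Hp.
rewrite /PiN; set P := [set _ | _].
suff -> : xget (fun=> 0) P = p by [].
apply: xget_unique.
  split => // v Xv; apply: complexI; rewrite (inner_XNr (has_coef_XN (XNB Xg Xp)) Xv).
  rewrite big_seq big1 ?mulr0 // => k kF.
  by rewrite (fhatB k Xg Xp) (has_coef_fhat Hp kF) subrr mul0r.
move=> r [Xr Hr]; apply: (XN_inj Xr Xp) => k kF.
have Xv : XN N (fun x => r x - p x) := has_coef_XN (has_coefB (XN_coef Xr) Hp).
have := congr1 (real_complex R) (Hr _ Xv).
rewrite /= (inner_XNr (has_coef_XN (XNB Xg Xr)) Xv) => /eqP.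
rewrite mulf_eq0 => /orP[/eqP /(congr1 (fun z => cRe z)) /= /eqP|].
  by rewrite sqrf_eq0 mulf_eq0 pnatr_eq0 /= gt_eqF ?pi_gt0.
have E : \sum_(k <- freqs N) fhat (fun x => g x - r x) k * fhat (fun x => r x - p x) (- k : Z2)
  = - (energy (freqs N) (fhat (fun x => r x - p x)))%:C.
  rewrite /energy real_complexS -sumrN !big_seq; apply: eq_bigr => l lF.
  rewrite (fhat_opp l Xv) -cn_mulJ (fhatB l Xg Xr) (fhatB l Xr Xp) (has_coef_fhat Hp lF).
  by move: (fhat r l) (fhat g l) => u v; ring.
rewrite E oppr_eq0 => /eqP /complexI e0.
have := energy_eq0 e0 kF; rewrite (fhatB k Xr Xp) => /eqP.
by rewrite subr_eq0 => /eqP.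
Qed.

Lemma nonlin_has_coef N f : XN N f ->
  has_coef N (nonlin N f) (fun k => 'i * (dsym k)%:C * tconv (freqs N) (fhat f) (fhat f) k).
Proof.
move=> Xf; have H2 := has_coef_sqr Xf.
have HD := Dx1_has_coef (has_coef_XN H2).
have HP := PiN_has_coef N (has_coef_XN HD).
apply: eq_has_coef (has_coefZ (- 2^-1) HP) => k kF.
have kF2 : k \in freqs (N + N).
  by move: kF; rewrite !mem_freqs => /leq_trans; apply; rewrite leq_addr.
rewrite (has_coef_fhat HD kF2) (has_coef_fhat H2 kF2) /dsym rmorphM /= rmorph_int.
by ring.
Qed.

Lemma len_opp (k : freq) : len R (- k : Z2) = len R k.
Proof. by rewrite /len /sqlen /= !mulrNz !sqrrN. Qed.

Lemma ellsymN (alpha : R) (k : freq) : ellsym alpha (- k : Z2) = - ellsym alpha k.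
Proof. by rewrite /ellsym len_opp /= mulrNz mulNr. Qed.

Lemma Cexp_Lsym (alpha t : R) (k : freq) :
  Cexp (t%:C * Lsym alpha k) = cis (t * ellsym alpha k).
Proof. by rewrite -Cexp_i; congr Cexp; rewrite /Lsym /ellsym (rmorphM _ t) /= mulrCA. Qed.

Lemma expL_has_coef N (alpha t : R) f c : has_coef N f c ->
  has_coef N (expL N alpha t f) (phase (ellsym alpha) t c).
Proof.
move=> Hf; have H : forall k, Cexp (t%:C * Lsym alpha (- k : Z2)) = conjc (Cexp (t%:C * Lsym alpha k)).
  by move=> k; rewrite !Cexp_Lsym -cisN ellsymN mulrN.
apply: eq_has_coef (fmult_has_coef (has_coef_XN Hf) H) => k kF.
by rewrite Cexp_Lsym (has_coef_fhat Hf kF).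
Qed.

Lemma rhsF_has_coef N (alpha t : R) f c : has_coef N f c ->
  has_coef N (rhsF N alpha t f)
    (ifB (ellsym alpha) (fun k => 'i * (dsym k)%:C) (freqs N) t c c).
Proof.
move=> Hf; have H1 := expL_has_coef alpha t Hf.
apply: eq_has_coef (expL_has_coef alpha (- t) (nonlin_has_coef (has_coef_XN H1))) => k kF.
rewrite /ifB /phase; congr (_ * (_ * _)); apply: eq_tconv => j jF;
  exact: has_coef_fhat H1 jF.
Qed.

(** Integrating factor, projection and stages all act on coefficients, so that
    a step of the scheme is a step of [ifrk4_coef]. *)
Lemma rk4_step_has_coef N (alpha h t : R) f c : has_coef N f c ->
  has_coef N (rk4_step N alpha h t f)
    (ifrk4_coef (ellsym alpha) (fun k => 'i * (dsym k)%:C) (freqs N) h t c).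
Proof.
move=> Hf; rewrite /rk4_step /ifrk4_coef.
set B := ifB _ _ _.
have half g c' : has_coef N g c' -> has_coef N (fun x => f x + g x / 2) (fun k => c k + c' k / 2).
  move=> Hg; have H := has_coefD Hf (has_coefZ 2^-1 Hg).
  have -> : (fun x => f x + g x / 2) = (fun x => f x + 2^-1 * g x).
    by apply/funext => x; rewrite mulrC.
  by apply: eq_has_coef H => k _; rewrite fmorphV rmorph_nat mulrC.
have K1 := has_coefZ h (rhsF_has_coef alpha t Hf).
have K2 := has_coefZ h (rhsF_has_coef alpha (t + h / 2) (half _ _ K1)).
have K3 := has_coefZ h (rhsF_has_coef alpha (t + h / 2) (half _ _ K2)).
have K4 := has_coefZ h (rhsF_has_coef alpha (t + h) (has_coefD Hf K3)).
have S := has_coefD (has_coefD (has_coefD K1 (has_coefZ 2 K2)) (has_coefZ 2 K3)) K4.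
apply: eq_has_coef (has_coefD Hf (has_coefZ 6^-1 S)) => k _.
by rewrite fmorphV !rmorph_nat.
Qed.

End SchemeCoefficients.

(** * The Galerkin equation in Fourier coefficients *)

Section GalerkinODE.
Variable R : realType.
Local Notation plane := (measurableTypeR R * measurableTypeR R)%type.
Implicit Types (N : nat) (f g : plane -> R) (c : freq -> R[i]).
Local Notation Z2 := (int * int)%type.

Lemma cis_2pi_int (m : int) : cis (m%:~R * (2 * pi)) = 1 :> R[i].
Proof.
have -> : m%:~R * (2 * pi) = (m%:~R * pi) *+ 2 :> R by rewrite -mulr_natl; ring.
rewrite /cis sin_mulr2n cos_mulr2n sin_int_pi mulr0 mul0rn.
by rewrite cos2sin2 sin_int_pi expr0n subr0; apply: complexP => //=; ring.
Qed.

Lemma cis_eq1 (x : R) : `|x| < 2 * pi -> cis x = 1 -> x = 0.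
Proof.
move=> xpi [cx _]; apply/eqP; apply: contraT => x0.
have s0 : sin (`|x| / 2) != 0.
  rewrite gt_eqF // sin_gt0_pi // divr_gt0 ?normr_gt0 //= ltr_pdivrMr //.
  by rewrite mulrC.
have : cos `|x| = 1 by case: (ger0P x) => _ //; rewrite cosN.
have {1}-> : `|x| = (`|x| / 2) *+ 2 by rewrite -mulr_natl mulrC divfK.
rewrite cos_mulr2n cos2sin2 => e.
have : sin (`|x| / 2) ^+ 2 = 0 by move: e; rewrite mulr2n; lra.
by move=> /eqP; rewrite sqrf_eq0 (negPf s0).
Qed.

Definition mesh N (a : nat) : R := a%:R * (2 * pi / N.*2.+1%:R).

(** A geometric sum of roots of unity. *)
Lemma sum_mesh N (m : int) : (`|m| <= N.*2)%N ->
  \sum_(a < N.*2.+1) cis (m%:~R * mesh N a) = N.*2.+1%:R * (m == 0)%:R :> R[i].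
Proof.
move=> mN; set n := N.*2.+1.
have n0 : n%:R != 0 :> R by rewrite pnatr_eq0.
have [->|m0] := eqVneq m 0.
  rewrite mulr1 (eq_bigr (fun=> 1)); last by move=> a _; rewrite mul0r cis0.
  by rewrite sumr_const card_ord.
rewrite mulr0; pose z : R[i] := cis (m%:~R * (2 * pi / n%:R)).
have zX a : cis (m%:~R * mesh N a) = z ^+ a.
  elim: a => [|a IH]; first by rewrite /mesh mul0r mulr0 cis0.
  by rewrite exprS -IH /z -cisD; congr cis; rewrite /mesh -natr1; ring.
rewrite (eq_bigr (fun a : 'I_n => z ^+ a)); last by move=> a _; exact: zX.
have zn : z ^+ n = 1.
  rewrite -zX -(cis_2pi_int m); congr cis; rewrite /mesh -/n.
  by rewrite [n%:R * _]mulrC divfK.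
have z1 : z != 1.
  apply/eqP => /cis_eq1 H.
  have : m%:~R * (2 * pi / n%:R) = 0 :> R.
    apply: H; have w0 : 0 < 2 * pi / n%:R :> R by rewrite divr_gt0 ?mulr_gt0 ?pi_gt0 ?ltr0n.
    have {2}-> : 2 * pi = n%:R * (2 * pi / n%:R) :> R by rewrite [RHS]mulrC divfK.
    rewrite normrM (ger0_norm (ltW w0)) ltr_pM2r //.
    by rewrite -intr_norm -natr_absz ltr_nat ltnS.
  move=> /eqP; rewrite !mulf_eq0 intr_eq0 (negPf m0) pnatr_eq0 /= invr_eq0 (negPf n0) orbF.
  by rewrite gt_eqF ?pi_gt0.
have := subrX1 z n; rewrite zn subrr => /esym /eqP.
by rewrite mulf_eq0 subr_eq0 (negPf z1) /= => /eqP.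
Qed.

Definition gridpt N (a b : nat) : plane := (mesh N a, mesh N b).

(** The discrete Fourier transform on a grid of [2 N + 1] points per direction:
    it recovers the coefficients of an element of [XN N] from finitely many
    point values, which makes them as regular in time as the point values. *)
Definition dft N f (k : freq) : R[i] :=
  (N.*2.+1%:R ^- 2) * \sum_(a < N.*2.+1) \sum_(b < N.*2.+1)
    (f (gridpt N a b))%:C * mode (- k : Z2) (gridpt N a b).

Lemma sum_grid_mode N (m : freq) : (`|m.1| <= N.*2)%N -> (`|m.2| <= N.*2)%N ->
  \sum_(a < N.*2.+1) \sum_(b < N.*2.+1) mode m (gridpt N a b) =
  N.*2.+1%:R ^+ 2 * (m == 0 :> Z2)%:R :> R[i].
Proof.
move=> m1 m2.
have -> : (m == 0 :> Z2) = (m.1 == 0) && (m.2 == 0) by case: m {m1 m2}.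
rewrite -mulnb natrM expr2 mulrACA -(sum_mesh m1) -(sum_mesh m2) mulr_suml.
apply: eq_bigr => a _; rewrite mulr_sumr; apply: eq_bigr => b _.
by rewrite modeE -cisD.
Qed.

Lemma dft_coef N f c (k : freq) : has_coef N f c -> k \in freqs N -> dft N f k = c k.
Proof.
move=> H kF; rewrite /dft.
have n0 : N.*2.+1%:R != 0 :> R[i] by rewrite pnatr_eq0.
have -> : \sum_(a < N.*2.+1) \sum_(b < N.*2.+1)
    (f (gridpt N a b))%:C * mode (- k : Z2) (gridpt N a b) =
  \sum_(l <- freqs N) c l * (\sum_(a < N.*2.+1) \sum_(b < N.*2.+1)
     mode (l - k : Z2) (gridpt N a b)).
  under [RHS]eq_bigr => l _ do rewrite mulr_sumr.
  rewrite [RHS]exchange_big; apply: eq_bigr => a _ /=.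
  under [RHS]eq_bigr => l _ do rewrite mulr_sumr.
  rewrite [RHS]exchange_big; apply: eq_bigr => b _ /=.
  by rewrite H mulr_suml; apply: eq_bigr => l _; rewrite modeD mulrA.
rewrite big_seq (eq_bigr (fun l => N.*2.+1%:R ^+ 2 * (c l * (l == k)%:R))); last first.
  move=> l lF; rewrite sum_grid_mode ?subr_eq0; first by rewrite mulrCA.
    by move: lF kF; rewrite !mem_freqs !geq_max /= => /andP[? _] /andP[? _]; lia.
  by move: lF kF; rewrite !mem_freqs !geq_max /= => /andP[_ ?] /andP[_ ?]; lia.
rewrite -big_seq -mulr_sumr mulrA mulVf ?mul1r ?expf_neq0 //.
by rewrite sum_delta ?freqs_uniq // kF.
Qed.

Lemma dft_fhat N f (k : freq) : XN N f -> k \in freqs N -> dft N f k = fhat f k.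
Proof. by move=> Xf kF; rewrite (dft_coef (XN_coef Xf) kF). Qed.

Lemma dft_cder N (a b : R) (u du : R -> plane -> R) (k : freq) :
  (forall x, rder a b (fun t => u t x) (fun t => du t x)) ->
  cder a b (fun t => dft N (u t) k) (fun t => dft N (du t) k).
Proof.
move=> H; apply: cderZ; apply: cder_sum => i _; apply: cder_sum => j _.
apply: cder_ext (cderZ (mode (- k : Z2) (gridpt N i j)) (_ : cder a b
    (fun t => (u t (gridpt N i j))%:C) (fun t => (du t (gridpt N i j))%:C))) => [t|t _|].
- by rewrite mulrC.
- by rewrite mulrC.
- by split; [exact: H|exact: rder_cst].
Qed.

Lemma inner_eq0 N f (k : freq) : XN N f -> inner f f = 0 -> k \in freqs N -> fhat f k = 0.
Proof.
move=> Xf; rewrite (inner_self Xf) => /eqP; rewrite mulf_eq0 sqrf_eq0 mulf_eq0 pnatr_eq0.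
rewrite (gt_eqF (pi_gt0 R)) => /= e0 kF; have e : energy (freqs N) (fhat f) = 0 by exact/eqP.
by apply: (energy_eq0 e).
Qed.

(** The velocity of a Galerkin solution is again in [XN N], and the equation
    tested with its own residual shows that the residual vanishes. *)
Lemma semidiscrete_tsol N (alpha a b : R) (u : R -> plane -> R) :
  semidiscrete N alpha a b u ->
  tsol (ellsym alpha) (@dsym R) (freqs N) a b (fun t => dft N (u t)).
Proof.
move=> [Xu cu du eqn] k kF.
pose p (t : R) (x : plane) : R := derive1 (fun s => u s x) t.
have Du x : rder a b (fun t => u t x) (fun t => p t x).
  split; first exact: cu.
  move=> t; rewrite in_itv /= => tab; rewrite /p derive1E.
  by apply: DeriveDef => //; exact: du.
have DY l := dft_cder N l Du.
apply: cder_ext (DY k) => // t; rewrite in_itv /= => tab.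
have tab' : a <= t <= b by case/andP: tab => t1 t2; rewrite !ltW.
have Xut := Xu t tab'.
have Hp : has_coef N (p t) (dft N (p t)).
  have E x : p t x = cRe (\sum_(l <- freqs N) dft N (p t) l * mode l x).
    pose G s := cRe (\sum_(l <- freqs N) dft N (u s) l * mode l x).
    have DG : rder a b G (fun s => cRe (\sum_(l <- freqs N) dft N (p s) l * mode l x)).
      have H : cder a b (fun s => \sum_(l <- freqs N) dft N (u s) l * mode l x)
          (fun s => \sum_(l <- freqs N) dft N (p s) l * mode l x).
        apply: cder_sum => l _; apply: cder_ext (cderZ (mode l x) (DY l)) => s *;
          by rewrite mulrC.
      by case: H.
    have tI : t \in `]a, b[ by rewrite in_itv.
    have [_ dE] : is_derive t 1 (fun s => u s x)
        (cRe (\sum_(l <- freqs N) dft N (p t) l * mode l x)).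
      apply: near_eq_is_derive (proj2 DG t tI).
      near=> s; rewrite /G.
      have sab : s \in `]a, b[ by near: s; exact: near_in_itvoo.
      have Xs : XN N (u s).
        by apply: Xu; move: sab; rewrite in_itv /= => /andP[s1 s2]; rewrite !ltW.
      have := congr1 (fun z => cRe z) (XN_coef Xs x); rewrite /= => ->.
      congr cRe; rewrite !big_seq; apply: eq_bigr => l lF.
      by rewrite (dft_fhat Xs lF).
    by rewrite /p derive1E dE.
  move=> x; rewrite [in LHS]E; apply: trig_real => l lF.
  rewrite /dft cJM cJ_sum; congr (_ * _).
    have -> : (N.*2.+1%:R ^- 2 : R[i]) = (N.*2.+1%:R ^- 2)%:C.
      by rewrite fmorphV rmorphXn /= rmorph_nat.
    by rewrite cJ_real.
  apply: eq_bigr => i _; rewrite cJ_sum; apply: eq_bigr => j _.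
  by rewrite cJM cJ_real modeN.
(* The residual of the equation, an admissible test function. *)
pose r x := p t x - Dx1 (fracLap N alpha (u t)) x - nonlin N (u t) x.
have HL : has_coef N (fracLap N alpha (u t)) (fun l => (len R l `^ alpha)%:C * fhat (u t) l).
  by apply: fmult_has_coef => // l; rewrite len_opp cJ_real.
have HDL := Dx1_has_coef (has_coef_XN HL).
have Hr := has_coefB (has_coefB Hp HDL) (nonlin_has_coef Xut).
have Xr : XN N r := has_coef_XN Hr.
have HDr := Dx1_has_coef Xr.
have rr : inner r r = 0.
  have := congr1 (real_complex R) (eqn t tab r Xr).
  rewrite -/(p t) => e0; apply: complexI; rewrite -[RHS]e0 {e0}.
  rewrite !rmorphB !rmorphD /= (rmorphM _ 2^-1) /=.
  rewrite (inner_XN Xr Xr) (inner_XN (has_coef_XN Hp) Xr).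
  rewrite (inner_XN (has_coef_XN HL) (has_coef_XN HDr)).
  rewrite (inner_XNr (has_coef_XN (has_coef_sqr Xut)) (has_coef_XN HDr)).
  rewrite -mulrDr mulrCA -mulrBr; congr (_ * _).
  rewrite mulr_sumr -big_split -sumrB /= !big_seq; apply: eq_bigr => l lF.
  have lF' := freqs_opp lF.
  have lF2 : l \in freqs (N + N).
    by move: lF; rewrite !mem_freqs => /leq_trans; apply; rewrite leq_addr.
  rewrite (has_coef_fhat HDr lF') (has_coef_fhat Hp lF) (has_coef_fhat HL lF).
  rewrite (has_coef_fhat (has_coef_sqr Xut) lF2) (has_coef_fhat Hr lF) (has_coef_fhat HL lF).
  move: (fhat r (- l : Z2)) (fhat (u t) l) (tconv _ _ _ _) => z1 z2 z3.
  have -> : (- l : Z2).1 = - l.1 by [].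
  have h2 : (2^-1)%:C = 2^-1 :> R[i] by rewrite fmorphV rmorph_nat.
  by rewrite /dsym rmorphM rmorphN /= rmorph_int h2 mulrNz; ring.
have := inner_eq0 Xr rr kF; rewrite (has_coef_fhat Hr kF) => /eqP.
rewrite -addrA -opprD subr_eq0 => /eqP ->.
rewrite (has_coef_fhat HL kF) (dft_fhat Xut kF); congr (_ + _).
  by rewrite /ellsym rmorphM /= rmorph_int; ring.
by congr (_ * _); apply: eq_tconv => j jF; rewrite (dft_fhat Xut jF).
Unshelve. all: by end_near.
Qed.

End GalerkinODE.

(** * Sobolev bounds control the weighted norms *)

Section Weights.
Variable R : realType.
Local Notation plane := (measurableTypeR R * measurableTypeR R)%type.
Local Notation Z2 := (int * int)%type.
Implicit Types (k j l : freq).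

Local Notation japan k := (1 + sqlen R k).

(** Powers of [weight] compare with every symbol of the equation, and the factor
    two makes it submultiplicative. *)
Definition weight (alpha : R) k : R := (2 * japan k) `^ ((1 + alpha) / 2).

Lemma sqlen_ge0 k : 0 <= sqlen R k.
Proof. by rewrite addr_ge0 ?sqr_ge0. Qed.

Lemma base_ge1 k : 1 <= 2 * japan k.
Proof. have := sqlen_ge0 k; lra. Qed.

Lemma len_sqr k : len R k ^+ 2 = sqlen R k.
Proof. by rewrite /len sqr_sqrtr ?sqlen_ge0. Qed.

Lemma len_ge0 k : 0 <= len R k. Proof. exact: sqrtr_ge0. Qed.

Lemma abs_le_len k : `|k.1%:~R| <= len R k.
Proof.
rewrite -(ler_pXn2r (n := 2)) ?nnegrE ?len_ge0 // len_sqr real_normK ?num_real //.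
by rewrite lerDl sqr_ge0.
Qed.

Lemma len_le_base k : len R k <= (2 * japan k) `^ 2^-1.
Proof.
rewrite powR12_sqrt ?(le_trans ler01 (base_ge1 k)) // ler_sqrt; last first.
  exact: le_trans ler01 (base_ge1 k).
have := sqlen_ge0 k; lra.
Qed.

Section FixedAlpha.
Variable alpha : R.
Hypothesis alpha0 : 0 < alpha.

Lemma weight_ge1 k : 1 <= weight alpha k.
Proof.
have e0 : 0 <= (1 + alpha) / 2 by rewrite divr_ge0 // addr_ge0 // ltW.
by have := ler_powR (base_ge1 k) e0; rewrite powRr0.
Qed.

Lemma weightD (j l : Z2) : weight alpha (j + l) <= weight alpha j * weight alpha l.
Proof.
have b k : 0 <= 2 * japan k by apply: le_trans ler01 (base_ge1 k).
have e0 : 0 <= (1 + alpha) / 2 by rewrite divr_ge0 // addr_ge0 // ltW.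
rewrite /weight -powRM ?b //; apply: (ge0_ler_powR e0); rewrite ?nnegrE ?b //.
  by apply: mulr_ge0; rewrite b.
have H (x y : R) : (x + y) ^+ 2 <= 2 * x ^+ 2 + 2 * y ^+ 2.
  by have := sqr_ge0 (x - y); lra.
have h1 := H (j.1%:~R) (l.1%:~R); have h2 := H (j.2%:~R) (l.2%:~R).
have p := mulr_ge0 (sqlen_ge0 j) (sqlen_ge0 l).
rewrite /sqlen /= !intrD; move: p; rewrite /sqlen; lra.
Qed.

Lemma ellsym_le k : `|ellsym alpha k| <= weight alpha k.
Proof.
rewrite /ellsym normrM (ger0_norm (powR_ge0 _ _)).
apply: (@le_trans _ _ ((2 * japan k) `^ 2^-1 * (2 * japan k) `^ (2^-1 * alpha))).
  apply: ler_pM; rewrite ?normr_ge0 ?powR_ge0 //.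
    exact: le_trans (abs_le_len k) (len_le_base k).
  rewrite powRrM ge0_ler_powR ?nnegrE ?len_ge0 ?powR_ge0 ?len_le_base //.
  exact: ltW.
rewrite -powRD; last by rewrite (gt_eqF (lt_le_trans ltr01 (base_ge1 k))) implybT.
by rewrite /weight le_eqVlt; apply/orP; left; apply/eqP; congr powR; field.
Qed.

Lemma dsym_le k : `|dsym R k| <= weight alpha k.
Proof.
apply: (@le_trans _ _ ((2 * japan k) `^ 2^-1)).
  rewrite /dsym normrM normrN (ger0_norm (x := 2^-1)) ?invr_ge0 ?ler0n //.
  apply: (le_trans _ (le_trans (abs_le_len k) (len_le_base k))).
  by rewrite ler_piMl ?invf_le1 ?ler1n.
by have a0 := alpha0; rewrite /weight ler_powR ?base_ge1 //; lra.
Qed.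

Lemma dsymD (j l : Z2) : dsym R (j + l) = dsym R j + dsym R l.
Proof. by rewrite /dsym /= intrD; ring. Qed.

End FixedAlpha.

(** A bounded function whose increments dominate [(1 + m ^ 2)^-1]. *)
Let phi (m : int) : R := 4 * (m%:~R / (1 + `|m%:~R|)).

Let phi_bound m : `|phi m| <= 4.
Proof.
have p : 0 < 1 + `|m%:~R| :> R by rewrite ltr_pwDl.
rewrite /phi normrM normf_div (ger0_norm (ltW p)) (ger0_norm (x := 4)) ?ler0n //.
by rewrite -[leRHS]mulr1 ler_wpM2l ?ler0n // ler_pdivrMr // mul1r lerDr.
Qed.

(* The increments of [m / (1 + |m|)] are [1 / (n (n + 1))] for neighbouring
   integers of absolute values [n - 1] and [n]. *)
Let phi_incr m : (1 + m%:~R ^+ 2)^-1 <= phi (m + 1) - phi m.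
Proof.
rewrite /phi intrD.
have p : 0 < 1 + (m%:~R : R) ^+ 2 by rewrite ltr_pwDl ?sqr_ge0.
have [m0|m0] := leP 0 m.
  have x0 : 0 <= (m%:~R : R) by rewrite ler0z.
  rewrite !ger0_norm ?addr_ge0 //; move: (m%:~R : R) x0 p => x x0 p.
  have -> : 4 * ((x + 1) / (1 + (x + 1))) - 4 * (x / (1 + x)) = 4 / ((1 + x) * (2 + x)).
    by field; rewrite !gt_eqF //; lra.
  have d0 : 0 < (1 + x) * (2 + x) by rewrite mulr_gt0 //; lra.
  rewrite -[leLHS]mul1r ler_pdivrMr // mulrAC ler_pdivlMr //.
  by have := sqr_ge0 (x - 2^-1); nra.
have x0 : (m%:~R : R) <= -1 by rewrite -(mulrN1z 1) ler_int; lia.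
rewrite !ler0_norm; [|lra|lra]; move: (m%:~R : R) x0 p => x x0 p.
have -> : 4 * ((x + 1) / (1 - (x + 1))) - 4 * (x / (1 - x)) = 4 / (- x * (1 - x)).
  by field; apply/and3P; split; [rewrite gt_eqF //|rewrite lt_eqF //|rewrite gt_eqF //]; lra.
have d0 : 0 < - x * (1 - x) by rewrite mulr_gt0 //; lra.
rewrite -[leLHS]mul1r ler_pdivrMr // mulrAC ler_pdivlMr //.
by nra.
Qed.

Lemma sum_inv_sqr N : \sum_(i <- iota 0 N.*2.+1) (1 + (i%:Z - N%:Z)%:~R ^+ 2)^-1 <= 8 :> R.
Proof.
have H n : \sum_(i <- iota 0 n) (1 + (i%:Z - N%:Z)%:~R ^+ 2)^-1 <=
    phi (n%:Z - N%:Z) - phi (- N%:Z) :> R.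
  elim: n => [|n IH]; first by rewrite big_nil sub0r subrr.
  rewrite -addn1 iotaD big_cat big_seq1 add0n.
  apply: le_trans (lerD IH (phi_incr _)) _.
  have -> : n%:Z - N%:Z + 1 = (n + 1)%N%:Z - N%:Z by lia.
  by rewrite addrC addrA subrK.
apply: le_trans (H _) _.
have := phi_bound (N.*2.+1%:Z - N%:Z); have := phi_bound (- N%:Z).
by rewrite !ler_norml => /andP[? ?] /andP[? ?]; lra.
Qed.

Lemma sum_japan N : \sum_(k <- freqs N) (japan k ^+ 2)^-1 <= 64.
Proof.
pose g (m : int) : R := (1 + m%:~R ^+ 2)^-1.
have g0 m : 0 <= g m by rewrite invr_ge0 addr_ge0 ?sqr_ge0.
pose X := \sum_(k <- freqs N) g k.1 * g k.2; apply: (@le_trans _ _ X).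
  have p m : 0 < 1 + (m%:~R : R) ^+ 2 by rewrite ltr_pwDl ?sqr_ge0.
  apply: ler_sum => k _; have q : 0 < japan k ^+ 2.
    by rewrite exprn_gt0 // ltr_pwDl ?sqlen_ge0.
  rewrite /g -invfM (lef_pV2 q (mulr_gt0 (p _) (p _))).

  rewrite /sqlen expr2; have := sqr_ge0 (k.1%:~R : R); have := sqr_ge0 (k.2%:~R : R).
  move: (_ ^+ 2) (_ ^+ 2) => x y x0 y0; nra.
have -> : X = (\sum_(i <- iota 0 N.*2.+1) g (i%:Z - N%:Z))
    * (\sum_(i <- iota 0 N.*2.+1) g (i%:Z - N%:Z)).
  rewrite mulr_suml; transitivity (\sum_(i <- iota 0 N.*2.+1) \sum_(j <- iota 0 N.*2.+1)
      g (i%:Z - N%:Z) * g (j%:Z - N%:Z)); first exact: big_allpairs_dep.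
  by apply: eq_bigr => i _; rewrite mulr_sumr.
have S := sum_inv_sqr N.
have -> : 64 = 8 * 8 :> R by ring.
by apply: ler_pM => //; apply: sumr_ge0 => i _; exact: g0.
Qed.

(** Finite partial sums of the series that defines the Sobolev norm. *)
Lemma Hnorm_sum (q Rb : R) N (f : plane -> R) : 0 <= Rb ->
  (Hnorm q f <= Rb%:E)%E ->
  \sum_(k <- freqs N) japan k `^ q * cn (fhat f k) ^+ 2 <= Rb ^+ 2.
Proof.
move=> Rb0; rewrite /Hnorm.
set F := fun k => _; set e := esum _ _ => H.
have F0 k : 0 <= japan k `^ q * cn (fhat f k) ^+ 2.
  by rewrite mulr_ge0 ?powR_ge0 ?sqr_ge0.
have le : ((\sum_(k <- freqs N) japan k `^ q * cn (fhat f k) ^+ 2)%:E <= e)%E.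
  apply: esum_ge; exists [set` freqs N].
    by split => //; exact: finite_seq.
  by rewrite -fsbig_seq ?freqs_uniq // sumEFin.
move: le H; case: e => [r||].
- rewrite lee_fin => le; rewrite poweR_EFin lee_fin => H.
  have r0 : 0 <= r by apply: le_trans le; apply: sumr_ge0.
  apply: le_trans le _; move: H; rewrite powR12_sqrt // => H.
  by rewrite -[leLHS](sqr_sqrtr r0) lerXn2r ?nnegrE ?sqrtr_ge0.
- by move=> _; rewrite poweRyr ?invr_eq0 ?pnatr_eq0.
- by rewrite leeNy_eq.
Qed.

(** Cauchy--Schwarz in arithmetic-geometric form: the five powers of the weight
    leave a summable factor because [q - 2] exceeds [5 (1 + alpha)]. *)
Lemma wnorm_Hnorm (alpha q Rb : R) : 0 < alpha <= 2 -> 4 * (1 + alpha) + 5 < q ->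
  0 <= Rb -> exists2 K, 0 <= K & forall N (f : plane -> R),
  (Hnorm q f <= Rb%:E)%E -> wnorm (freqs N) (weight alpha) 5 (fhat f) <= K.
Proof.
move=> /andP[alpha0 alpha2] hq Rb0.
pose c : R := 2 `^ (5 * (1 + alpha)).
have c0 : 0 <= c by exact: powR_ge0.
(* [w z <= (w ^ 2 / s + s z ^ 2) / 2] with [s] the Sobolev weight. *)
exists (2^-1 * (c * 64 + Rb ^+ 2)) => [|N f H].
  by rewrite mulr_ge0 ?invr_ge0 // addr_ge0 ?mulr_ge0 ?sqr_ge0.
move: (fhat f) (Hnorm_sum N Rb0 H) => F S.
apply: (@le_trans _ _ (2^-1 * (c * (\sum_(k <- freqs N) (japan k ^+ 2)^-1) +
   \sum_(k <- freqs N) japan k `^ q * cn (F k) ^+ 2))); last first.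
  by rewrite ler_wpM2l ?invr_ge0 // lerD // ler_wpM2l // sum_japan.
rewrite mulr_sumr -big_split /= mulr_sumr; apply: ler_sum => k _.
have j1 : 1 <= japan k by rewrite lerDl sqlen_ge0.
have j0 : 0 < japan k by exact: lt_le_trans j1.
set s := japan k `^ q; set z := cn _.
have s0 : 0 < s by exact: powR_gt0.
have key : (weight alpha k ^+ 5) ^+ 2 <= c * (japan k ^+ 2)^-1 * s.
  rewrite -exprM /weight -powR_mulrn ?powR_ge0 // -powRrM.
  have -> : (1 + alpha) / 2 * (5 * 2)%N%:R = 5 * (1 + alpha) by rewrite natrM; field.
  rewrite powRM ?ler0n ?(ltW j0) // -/c -mulrA ler_wpM2l //.
  have -> : (japan k ^+ 2)^-1 = japan k `^ (- 2) by rewrite powRN powR_mulrn // ltW.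
  rewrite /s -powRD; last by rewrite (gt_eqF j0) implybT.
  by rewrite ler_powR //; lra.
set w := weight alpha k ^+ 5; rewrite -/w in key.
have w0 : 0 <= w by rewrite exprn_ge0 // powR_ge0.
move: key; set t := c * _ => key.
have t0 : 0 <= t by rewrite mulr_ge0 // invr_ge0 exprn_ge0 // ltW.
have z0 : 0 <= z by exact: cn_ge0.
clearbody w t s z.
have h : w * z <= Num.sqrt t * Num.sqrt s * z.
  rewrite ler_wpM2r // -(ler_pXn2r (n := 2)) ?nnegrE ?mulr_ge0 ?sqrtr_ge0 //.
  by rewrite exprMn !sqr_sqrtr // ltW.
have h2 := sqr_ge0 (Num.sqrt t - Num.sqrt s * z).
have e1 := sqr_sqrtr t0; have e2 := sqr_sqrtr (ltW s0).
apply: le_trans h _.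
have -> : s * z ^+ 2 = (Num.sqrt s * z) ^+ 2 by rewrite exprMn e2.
rewrite -[X in X + _]e1 -mulrA.
by move: (Num.sqrt t) (Num.sqrt s * z) h2 => x y h2; lra.
Qed.

End Weights.

(** * Convergence of the fully discrete scheme *)

Lemma ifrk4_XN (R : realType) N (alpha dt : R) (u0 : R * R -> R) n :
  XN N (ifrk4 N alpha dt u0 n).
Proof.
elim: n => [|n IH] /=; first exact: PiN_XN.
exact: has_coef_XN (rk4_step_has_coef alpha dt _ (XN_coef IH)).
Qed.

Theorem theorem5p6 (R : realType) (alpha q Rb : R)
  (halpha : 0 < alpha <= 2) (hq : 4 * (1 + alpha) + 5 < q) (hRb : 0 < Rb) :
  exists2 h0 : R, 0 < h0 &
  forall (T : R) (u0 : R * R -> R), 0 < T -> L2per u0 ->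
  exists2 C : R, 0 < C &
  forall (N M : nat) (uN : R -> R * R -> R) (w : nat -> R -> R * R -> R),
    (0 < M)%N ->
    let dt := T / M%:R in
    let t (n : nat) := n%:R * dt in
    dt <= h0 ->
    semidiscrete N alpha 0 T uN ->
    uN 0 = PiN N u0 ->
    (ereal_sup [set Hnorm q (uN s) | s in `[0%R, T]%classic] <= Rb%:E)%E ->
    (forall n, (n < M)%N ->
       semidiscrete N alpha (t n) (t n.+1) (w n) /\
       w n (t n) = fully_discrete N alpha dt u0 n) ->
    (ereal_sup [set ereal_sup [set Hnorm q (w n s) | s in `[t n, t n.+1]%classic] |
      n in [set n | (n < M)%N]] <= Rb%:E)%E ->
    forall n, (n <= M)%N ->
      L2norm (fun x => uN (t n) x - fully_discrete N alpha dt u0 n x)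
        <= C * dt ^+ 4.
Proof.
(* The step is only compared with [1] to order its powers: stability comes from
   the exact flow, so that no relation between the step and [N] arises. *)
exists 1 => // T u0 T0 _.
have alpha0 : 0 < alpha by case/andP: halpha.
have [K K0 HK] := wnorm_Hnorm halpha hq (ltW hRb).
have [C C0 HC] := ifrk4_coef_convergence (weight_ge1 alpha0) (weightD alpha0) (ellsym_le alpha0)
  (dsym_le alpha0) (@dsymD R) K0 T0.
(* [2 * pi] is the factor in Parseval's identity; the summand [1] makes the
   constant positive. *)
exists (2 * pi * Num.sqrt C + 1) => [|N M uN w M0 dt t dt1 HuN uN0 supU Hw supw n nM].
  by rewrite ltr_wpDl // !mulr_ge0 ?sqrtr_ge0 // pi_ge0.
have dt0 : 0 < dt by rewrite divr_gt0 // ltr0n.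
have tM m : (m <= M)%N -> 0 <= t m <= T.
  move=> mM; rewrite mulr_ge0 ?(ltW dt0) //=.
  have -> : T = M%:R * dt by rewrite mulrC divfK // pnatr_eq0 -lt0n.
  by rewrite ler_wpM2r ?ler_nat // ltW.
have XU s : 0 <= s <= T -> XN N (uN s) by case: HuN => H _ _ _; exact: H.
have Xw m s : (m < M)%N -> t m <= s <= t m.+1 -> XN N (w m s).
  by move=> mM; case: (Hw m mM) => -[H _ _ _] _; exact: H.
have HU s : 0 <= s <= T -> (Hnorm q (uN s) <= Rb%:E)%E.
  move=> sT; apply: le_trans supU; apply: ereal_sup_ubound.
  by exists s => //=; rewrite in_itv.
have HW m s : (m < M)%N -> t m <= s <= t m.+1 -> (Hnorm q (w m s) <= Rb%:E)%E.
  move=> mM st; apply: le_trans supw.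
  apply: (@le_trans _ _ (ereal_sup [set Hnorm q (w m s) | s in `[t m, t m.+1]%classic])).
    by apply: ereal_sup_ubound; exists s => //=; rewrite in_itv.
  by apply: ereal_sup_ubound; exists m.
have herm (f : R * R -> R) : XN N f -> hermitian (freqs N) (dft N f).
  by move=> Xf k kF; rewrite !dft_fhat ?(freqs_opp kF) // (fhat_opp k Xf).
have bound (f : R * R -> R) : XN N f -> (Hnorm q f <= Rb%:E)%E ->
    wnorm (freqs N) (weight alpha) 5 (dft N f) <= K.
  move=> Xf Hf; rewrite (eq_wnorm (weight_ge1 alpha0) _ (g := fhat f)) ?HK // => k kF.
  exact: dft_fhat.
pose V m := fhat (ifrk4 N alpha dt u0 m).
have HV m : has_coef N (ifrk4 N alpha dt u0 m) (V m).
  by apply: XN_coef; exact: ifrk4_XN.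
have Hd m : has_coef N (fully_discrete N alpha dt u0 m) (phase (ellsym alpha) (t m) (V m)).
  exact: expL_has_coef.
have E := HC (freqs N) M (fun s => dft N (uN s)) (fun m s => dft N (w m s)) V
  (freqs_uniq N) (@freqs_opp N) M0 dt1 (semidiscrete_tsol HuN)
  (fun s sT => herm _ (XU s sT)) (fun s sT => bound _ (XU s sT) (HU s sT))
  (fun m mM => semidiscrete_tsol (proj1 (Hw m mM)))
  (fun m s mM st => herm _ (Xw m s mM st))
  (fun m s mM st => bound _ (Xw m s mM st) (HW m s mM st)).
have {}E : energy (freqs N) (fun k => dft N (uN (t n)) k -
    phase (ellsym alpha) (t n) (V n) k) <= C * dt ^+ 8.
  apply: E => // [m k mM kF|k kF|m k mM kF].
  - rewrite -/dt -/(t m) (proj2 (Hw m mM)); exact: dft_coef.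
  - by rewrite uN0 dft_fhat //; exact: PiN_XN.
  - exact: has_coef_fhat (rk4_step_has_coef alpha dt (t m) (HV m)) kF.
have Xn := XU _ (tM n nM).
have Hdiff := has_coefB (XN_coef Xn) (Hd n).
rewrite (L2norm_XN (has_coef_XN Hdiff)).
have -> : energy (freqs N) (fhat (fun x => uN (t n) x - fully_discrete N alpha dt u0 n x)) =
  energy (freqs N) (fun k => dft N (uN (t n)) k - phase (ellsym alpha) (t n) (V n) k).
  by apply: eq_energy => k kF; rewrite (has_coef_fhat Hdiff kF) dft_fhat.
apply: (@le_trans _ _ (2 * pi * Num.sqrt C * dt ^+ 4)).
  rewrite -[leRHS]mulrA ler_wpM2l ?mulr_ge0 ?pi_ge0 //.
  have -> : Num.sqrt C * dt ^+ 4 = Num.sqrt (C * dt ^+ 8).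
    have -> : dt ^+ 8 = (dt ^+ 4) ^+ 2 by rewrite -exprM.
    by rewrite sqrtrM // sqrtr_sqr ger0_norm // exprn_ge0 // ltW.
  by rewrite ler_sqrt // mulr_ge0 // exprn_ge0 // ltW.
by rewrite ler_wpM2r ?exprn_ge0 ?(ltW dt0) // lerDl.
Qed.
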